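(* Let $n\ge 1$, let $T$ and $b$ be positive constants, and let $\Omega$ be an open subset of $\mathbb{R}^n$. Suppose $u$ is a $C^{2,1}$ nonnegative solution of $$0\le u_t-\Delta u\le b\left(u+\frac{1}{(\sqrt t)^{\,n}}\right)^{1+2/n}\quad\text{in}\quad\Omega\times(0,T).$$ Then, for each compact subset $K$ of $\Omega$, $$\max_{x\in K}u(x,t)=O(t^{-n/2})\quad\text{as}\quad t\to 0^+.$$
   Context: $u=u(x,t)$ is a real-valued function; $u_t$ is the partial derivative in $t$ and $\Delta$ is the Laplacian in the spatial variable $x\in\mathbb{R}^n$. $C^{2,1}$ means that $u$, its first and second order partial derivatives in $x$, and its first order partial derivative in $t$ exist and are continuous on the domain of $u$, here $\Omega\times(0,T)$. No boundary conditions are imposed on $u$. *)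

(* Defs.v *)
From HB Require Import structures.
From mathcomp Require Import all_boot all_order all_algebra.
From mathcomp Require Import all_classical all_reals all_analysis.
Set Implicit Arguments.
Unset Strict Implicit.
Unset Printing Implicit Defensive.
Import Order.TTheory GRing.Theory Num.Theory.
Import numFieldNormedType.Exports.
Local Open Scope classical_set_scope.
Local Open Scope ring_scope.

(* Points of R^n are row vectors; the sup norm of 'rV[R]_n induces the usual
   topology. A function of (x, t) is total, and only its values on
   Omega x J are constrained; the derivatives below are taken at points of
   that set, which is open in every use. *)

Definition pderiv (R : realType) (n : nat) (i : 'I_n) (f : 'rV[R]_n -> R)
  (x : 'rV[R]_n) : R := 'D_(delta_mx 0 i) f x.

Definition pderivable (R : realType) (n : nat) (i : 'I_n) (f : 'rV[R]_n -> R)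
  (x : 'rV[R]_n) : Prop := derivable f x (delta_mx 0 i).

Definition laplacian (R : realType) (n : nat) (f : 'rV[R]_n -> R)
  (x : 'rV[R]_n) : R := \sum_(i < n) pderiv i (pderiv i f) x.

Definition cont_on (R : realType) (n : nat) (Omega : set 'rV[R]_n) (J : set R)
    (v : 'rV[R]_n -> R -> R) : Prop :=
  {within Omega `*` J, continuous (fun p : 'rV[R]_n * R => v p.1 p.2)}.

Definition C21_on (R : realType) (n : nat) (Omega : set 'rV[R]_n) (J : set R)
    (u : 'rV[R]_n -> R -> R) : Prop :=
  [/\ cont_on Omega J u,
      forall i : 'I_n,
        (forall (x : 'rV[R]_n) (t : R), Omega x -> J t -> pderivable i (u^~ t) x) /\
        cont_on Omega J (fun x t => pderiv i (u^~ t) x),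
      forall i j : 'I_n,
        (forall (x : 'rV[R]_n) (t : R), Omega x -> J t -> pderivable j (pderiv i (u^~ t)) x) /\
        cont_on Omega J (fun x t => pderiv j (pderiv i (u^~ t)) x)
    & (forall (x : 'rV[R]_n) (t : R), Omega x -> J t -> derivable (u x) t 1) /\
      cont_on Omega J (fun x t => derive1 (u x) t)].

Definition is_max (R : realType) (A : set R) (m : R) : Prop :=
  A m /\ ubound A m.

(* Main.v *)
(* Everything rests on the weak maximum principle; no integration is needed.
   Suppose u(x, t) t^(n/2) is unbounded near (z, 0).  Maximizing u times the
   n-th power of the parabolic distance to the boundary of a small cylinder
   gives points (x1, t1) -> (z, 0) where u = M = r^-n, with r much smaller than
   sqrt t1, and u <= 2^n M on a backward cylinder of size r.  There the exponent
   1 + 2/n gives 0 <= u_t - Delta u <= C M / r^2, hence a gradient bound of order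
   M / r, hence u(., t1) >= M / 2 on a cube of side comparable to r: a quantum of
   mass, independent of the point, sits in u at time t1.
   These quanta add up.  Choosing such points at times decreasing fast enough,
   the heat evolved from the earlier quanta is at most N c t1^(-n/2), much less
   than M, at time t1, so a new bump of size M / 4 still fits below u.  After N
   steps, the value of u at a fixed later point exceeds N times a positive
   constant, for every N. *)
Require Import Defs.
From HB Require Import structures.
From mathcomp Require Import all_boot all_order all_algebra.
From mathcomp Require Import all_classical all_reals all_analysis.
From mathcomp Require Import ring lra.
Import Order.TTheory GRing.Theory Num.Theory.
Import numFieldNormedType.Exports.
Local Open Scope classical_set_scope.
Local Open Scope ring_scope.

(** * Second derivatives on a line and the heat operator on slices *)

(** The first derivative is a witness given near [a] only, so sums and multiples are formed without
    computing iterated derivatives. *)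
Definition deriv2_at {R : realType} (g : R -> R) (a d : R) :=
  exists2 g' : R -> R, (\forall s \near a, is_derive (s : R) (1 : R) g (g' s)) &
    is_derive a 1 g' d.

Lemma deriv2_atD {R : realType} (f g : R -> R) a c d :
  deriv2_at f a c -> deriv2_at g a d ->
  deriv2_at (fun s => f s + g s) a (c + d).
Proof.
move=> [f' Hf Hf'] [g' Hg Hg']; exists (fun s => f' s + g' s); last first.
  exact: is_deriveD.
near=> s; apply: is_deriveD; [near: s; exact: Hf|near: s; exact: Hg].
Unshelve. all: by end_near. Qed.

Lemma deriv2_atZ {R : realType} (f : R -> R) a k d :
  deriv2_at f a d -> deriv2_at (fun s => k * f s) a (k * d).
Proof.
move=> [f' Hf Hf']; exists (fun s => k * f' s); last exact: is_deriveZ.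
near=> s; apply: is_deriveZ; near: s; exact: Hf.
Unshelve. all: by end_near. Qed.

Lemma deriv2_at_cst {R : realType} (a k : R) : deriv2_at (fun=> k) a 0.
Proof.
by exists (fun=> 0); [near=> s|]; exact: is_derive_cst.
Unshelve. all: by end_near. Qed.


Lemma deriv2_at_reflect {R : realType} (f : R -> R) d :
  deriv2_at f 0 d -> deriv2_at (fun s => f (- s)) 0 d.
Proof.
move=> [f' Hf Hf']; exists (fun s => - f' (- s)); last first.
  have H : is_derive (- 0 : R) 1 f' d by rewrite oppr0.
  have := is_deriveN (is_derive1_comp H (is_deriveNid (0:R) 1)).
  by rewrite mulrN1 opprK.
move: Hf => /nbhs_ballP[e /= e0 He]; apply/nbhs_ballP; exists e => //= s se.
have H : is_derive (- s : R) (1 : R) f (f' (- s)).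
  by apply: He; move: se; rewrite /ball /= !sub0r opprK normrN.
have := is_derive1_comp H (is_deriveNid (s:R) 1).
by rewrite mulrN1.
Qed.

Lemma diff_quotient_gt0 {R : realType} (f : R -> R) (a d : R) :
  is_derive a (1 : R) f d -> 0 < d ->
  exists2 e, 0 < e & forall h, h != 0 -> `|h| < e ->
    0 < h^-1 * (f (a + h) - f a).
Proof.
move=> [df <-] d0.
have : \forall h \near 0^', 0 < h^-1 *: ((f \o shift a) (h *: 1) - f a).
  by move/cvgr_gt: df; apply.
move=> /nbhs_ballP[e /= e0 He]; exists e => // h h0 he.
have := He h; rewrite /= /ball /= sub0r normrN => /(_ he h0).
by rewrite /GRing.scale /= mulr1 (addrC h).
Qed.

(** If [d] were positive, [f'], which vanishes at the maximum, would be positive just to the right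
    of [a], and the mean value theorem would make [f] exceed [f a] there. *)
Lemma deriv2_at_le0 {R : realType} (f : R -> R) a d :
  deriv2_at f a d -> (\forall s \near a, f s <= f a) -> d <= 0.
Proof.
move=> [f' /nbhs_ballP[e1 /= e10 H1] H2] /nbhs_ballP[e2 /= e20 H3].
rewrite leNgt; apply/negP => d0.
have [e3 e30 H4] := diff_quotient_gt0 _ _ _ H2 d0.
pose e := Num.min e1 e2.
have e0 : 0 < e by rewrite /e lt_min e10.
have near_a s : s \in `]a - e, a + e[ -> `|a - s| < e.
  by rewrite in_itv /= ltr_distlC.
have f'a : f' a = 0.
  have Ha : is_derive a (1 : R) f (f' a) by apply: H1; exact: ballxx.
  have Hm : is_derive a (1 : R) f 0.
    apply: (@derive1_at_max _ f (a - e) (a + e)); first by lra.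
    - move=> t /near_a te; have [] // := H1 t.
      by rewrite /ball /= (lt_le_trans te) // ge_min lexx.
    - by rewrite in_itv /=; apply/andP; split; lra.
    - move=> t /near_a te; apply: H3.
      by rewrite /ball /= (lt_le_trans te) // ge_min lexx orbT.
  by rewrite -(@derive_val _ _ _ _ _ _ _ Ha) (@derive_val _ _ _ _ _ _ _ Hm).
pose h := Num.min e e3 / 2.
have m0 : 0 < Num.min e e3 by rewrite lt_min e0.
have h0 : 0 < h by rewrite /h; lra.
have me : Num.min e e3 <= e by rewrite ge_min lexx.
have me3 : Num.min e e3 <= e3 by rewrite ge_min lexx orbT.
have he : h < e by rewrite /h; lra.
have he3 : h < e3 by rewrite /h; lra.
have D x : a - e < x < a + e -> is_derive x (1 : R) f (f' x).
  move=> xe; apply: H1; rewrite /ball /=.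
  by apply: (@lt_le_trans _ _ e); [apply: near_a; rewrite in_itv|rewrite ge_min lexx].
have [|||c] := @MVT _ f f' a (a + h).
- by rewrite ltrDl.
- by move=> x; rewrite in_itv /= => /andP[? ?]; apply: D; apply/andP; split; lra.
- apply: derivable_within_continuous => x; rewrite in_itv /= => /andP[? ?].
  by have [] // := D x; apply/andP; split; lra.
rewrite in_itv /= => /andP[ac ch] E.
have : f (a + h) <= f a.
  apply: H3; rewrite /ball /=; apply: (@lt_le_trans _ _ e).
    by rewrite opprD addNKr normrN gtr0_norm.
  by rewrite ge_min lexx orbT.
have := H4 (c - a); rewrite subr_eq0 gt_eqF // => /(_ isT).
have -> : `|c - a| < e3 by rewrite gtr0_norm; lra.
move=> /(_ isT); rewrite f'a subr0 (addrC a) subrK.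
rewrite pmulr_rgt0; last by rewrite invr_gt0 subr_gt0.
move=> fc; rewrite -subr_le0 E pmulr_rle0 //; lra.
Qed.

(** Only past values are compared, since a maximum over a space-time cylinder may sit at the final
    time. *)
Lemma is_derive_ge0_left_max {R : realType} (f : R -> R) (a d e : R) :
  is_derive a (1 : R) f d -> 0 < e ->
  (forall s, a - e <= s -> s <= a -> f s <= f a) -> 0 <= d.
Proof.
move=> H e0 Hm; rewrite leNgt; apply/negP => d0.
have HN := is_deriveN H.
have [|e1 e10 H4] := diff_quotient_gt0 _ _ _ HN; first by rewrite oppr_gt0.
have m0 : 0 < Num.min e e1 by rewrite lt_min e0.
pose h := - (Num.min e e1 / 2).
have h0 : h < 0 by rewrite /h; lra.
have me : Num.min e e1 <= e by rewrite ge_min lexx.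
have me1 : Num.min e e1 <= e1 by rewrite ge_min lexx orbT.
have he : - e <= h by rewrite /h; lra.
have he1 : - e1 < h by rewrite /h; lra.
have := H4 h; rewrite lt_eqF // ltr0_norm // => /(_ isT).
have -> : - h < e1 by lra.
move=> /(_ isT); rewrite /= opprK nmulr_rgt0 ?invr_lt0 //.
have : f (a + h) <= f a by apply: Hm; lra.
by rewrite /GRing.opp /=; lra.
Qed.

(* [w_t - Delta w] exists and equals [q] at [(x, t)], all derivatives being
   taken on one-dimensional slices. *)
Definition heat_at {R : realType} {n : nat} (w : 'rV[R]_n -> R -> R)
    (x : 'rV[R]_n) (t q : R) :=
  exists (dt : R) (d : 'I_n -> R),
    [/\ is_derive t (1 : R) (w x) dt,
        forall i, deriv2_at (fun s => w (x + s *: delta_mx 0 i) t) 0 (d i)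
      & q = dt - \sum_i d i].

Lemma heat_atD {R : realType} {n : nat} (v w : 'rV[R]_n -> R -> R) x t p q :
  heat_at v x t p -> heat_at w x t q ->
  heat_at (fun x t => v x t + w x t) x t (p + q).
Proof.
move=> [a [c [Ha Hc ->]]] [b [d [Hb Hd ->]]].
exists (a + b), (fun i => c i + d i); split.
- exact: is_deriveD.
- by move=> i; exact: deriv2_atD.
- by rewrite big_split /=; ring.
Qed.

Lemma heat_atZ {R : realType} {n : nat} (w : 'rV[R]_n -> R -> R) x t k q :
  heat_at w x t q -> heat_at (fun x t => k * w x t) x t (k * q).
Proof.
move=> [a [c [Ha Hc ->]]].
exists (k * a), (fun i => k * c i); split.
- exact: is_deriveZ.
- by move=> i; exact: deriv2_atZ.
- by rewrite -mulr_sumr mulrBr.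
Qed.

Lemma heat_atB {R : realType} {n : nat} (v w : 'rV[R]_n -> R -> R) x t p q :
  heat_at v x t p -> heat_at w x t q ->
  heat_at (fun x t => v x t - w x t) x t (p - q).
Proof.
move=> Hv /(heat_atZ _ _ _ (-1)) /(heat_atD _ _ _ _ _ _ Hv).
rewrite mulN1r; set f := fun _ => _; set g := fun _ => _.
suff -> : f = g by [].
by apply/funext => y; apply/funext => s; rewrite /f /g mulN1r.
Qed.

Lemma heat_at_cst {R : realType} {n : nat} (k : R) (x : 'rV[R]_n) t :
  heat_at (fun _ _ => k) x t 0.
Proof.
exists 0, (fun=> 0); split; first exact: is_derive_cst.
- by move=> i; exact: deriv2_at_cst.
- by rewrite big1 // subrr.
Qed.

Lemma heat_at_time {R : realType} {n : nat} (k : R) (x : 'rV[R]_n) t :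
  heat_at (fun _ s => s - k) x t 1.
Proof.
exists 1, (fun=> 0); split; last by rewrite big1 // subr0.
- by rewrite -[X in is_derive _ _ _ X]subr0; apply: is_deriveB.
- by move=> i; exact: deriv2_at_cst.
Qed.

Definition reflect_coord {R : realType} {n : nat} (i : 'I_n) (a : R)
    (x : 'rV[R]_n) : 'rV[R]_n :=
  x + (2 * (a - x 0 i)) *: delta_mx 0 i.

(** The reflection reverses the slice in direction [i], which preserves its second derivative at 0,
    and leaves the slices in the other directions as they are. *)
Lemma heat_at_reflect {R : realType} {n : nat} (w : 'rV[R]_n -> R -> R) x t q
    i a :
  heat_at w (reflect_coord i a x) t q ->
  heat_at (fun x => w (reflect_coord i a x)) x t q.
Proof.
move=> [c [d [Hc Hd ->]]]; exists c, d; split => // j.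
have [->|ji] := eqVneq j i.
  have := deriv2_at_reflect _ _ (Hd i).
  set f := fun _ => _; set g := fun _ => _; suff -> : f = g by [].
  apply/funext => s; rewrite /f /g /reflect_coord !mxE !eqxx mulr1 -!addrA.
  by rewrite -!scalerDl; congr (w (_ + _ *: _) t); ring.
have := Hd j; set f := fun _ => _; set g := fun _ => _; suff -> : f = g by [].
apply/funext => s; rewrite /f /g /reflect_coord !mxE [i == j]eq_sym (negbTE ji) andbF mulr0.
by rewrite addr0 addrAC.
Qed.

Lemma derive_slice {R : realType} {n : nat} (f : 'rV[R]_n -> R) x v (s : R) :
  derivable f (x + s *: v) v ->
  is_derive s (1 : R) (fun h => f (x + h *: v)) ('D_v f (x + s *: v)).
Proof.
move=> fd; have E : (fun h : R => h^-1 *: ((f \o shift (x + s *: v)) (h *: v)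
    - f (x + s *: v))) =
  (fun h : R => h^-1 *: (((fun h => f (x + h *: v)) \o shift s) (h *: (1 : R))
    - f (x + s *: v))).
  apply/funext => h /=; congr (_ *: (f _ - _)).
  by rewrite addrCA -scalerDl /GRing.scale /= mulr1.
by split; rewrite /derivable /derive -E.
Qed.

Lemma heat_at_C21 {R : realType} {n : nat} (Omega : set 'rV[R]_n) J u x t :
  open Omega -> C21_on Omega J u -> Omega x -> J t ->
  heat_at u x t (derive1 (u x) t - laplacian (u^~ t) x).
Proof.
move=> oO [_ ux uxx [ut _]] Ox Jt.
exists (derive1 (u x) t), (fun i => pderiv i (pderiv i (u^~ t)) x); split => //.
  by rewrite derive1E; apply: derivableP; exact: ut.
move=> i; have x0 : x + (0 : R) *: delta_mx 0 i = x by rewrite scale0r addr0.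
exists (fun s => pderiv i (u^~ t) (x + s *: delta_mx 0 i)).
  have : (x + s *: delta_mx 0 i) @[s --> (0:R)] --> x.
    rewrite -[X in _ --> X]x0; apply: cvgD; first exact: cvg_cst.
    by apply: cvgZ; [exact: cvg_id|exact: cvg_cst].
  move=> /(_ Omega (open_nbhs_nbhs (conj oO Ox))) nO.
  near=> s; have [H _] := ux i; apply: derive_slice; apply: H => //.
  by near: s; exact: nO.
have [H _] := uxx i i.
have := @derive_slice _ _ (pderiv i (u^~ t)) x (delta_mx 0 i) 0.
rewrite {1 2}x0; apply; exact: H.
Unshelve. all: by end_near. Qed.

(** * The weak maximum principle *)

(** No boundary is named: the last hypothesis asks for room in space and into the past only where
    [w] is positive, which encodes [w <= 0] on the parabolic boundary of [K]. Subtracting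
    [e * (s - t0)] makes the subsolution strict, and a strict one has no positive maximum at a point
    with such room. *)
Lemma weak_max_principle {R : realType} {n : nat} (K : set ('rV[R]_n * R))
    (w : 'rV[R]_n -> R -> R) (t0 : R) :
  compact K ->
  (forall p, K p -> {for p, continuous (fun p => w p.1 p.2)}) ->
  (forall p, K p -> t0 <= p.2) ->
  (forall x t, K (x, t) -> 0 < w x t -> exists q e : R,
    [/\ heat_at w x t q, q <= 0, 0 < e,
        forall i, \forall s \near (0 : R), K (x + s *: delta_mx 0 i, t)
      & forall s, t - e <= s -> s <= t -> K (x, s)]) ->
  forall x t, K (x, t) -> w x t <= 0.
Proof.
move=> cK cw tK HK x t Kxt; apply/ler_addgt0Pr => eta eta0.
have t1 : 0 < t - t0 + 1 by have /= := tK _ Kxt; lra.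
(* With this slope the correction is at most [eta] at time [t]; the added 1 keeps the denominator
   positive when [t = t0]. *)
pose e := eta / (t - t0 + 1).
have e0 : 0 < e by rewrite divr_gt0.
pose v (x : 'rV[R]_n) s := w x s - e * (s - t0).
have cv : {within K, continuous (fun p => v p.1 p.2)}.
  apply: continuous_in_subspaceT => p /set_mem Kp; apply: cvgB; first exact: cw.
  apply: cvgM; first exact: cvg_cst.
  by apply: cvgB; [exact: cvg_snd|exact: cvg_cst].
have [[y s] /set_mem Kys ymax] :=
  compact_EVT_max (ex_intro _ _ Kxt : K !=set0) cK cv.
have vmax z r : K (z, r) -> v z r <= v y s.
  by move=> Kzr; have := ymax (z, r); apply; exact: mem_set.
have es : e * (t - t0) <= eta.
  rewrite -[leRHS](@divfK _ (t - t0 + 1)) ?gt_eqF // -/e ler_pM2l //; lra.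
suff vy : v y s <= 0.
  by rewrite add0r; have := le_trans (vmax _ _ Kxt) vy; rewrite /v; lra.
rewrite leNgt; apply/negP => vy.
have wy : 0 < w y s.
  apply: (lt_le_trans vy); rewrite /v gerBl; apply: mulr_ge0; first exact: ltW.
  by rewrite subr_ge0; exact: (tK _ Kys).
have [q [d [Hq q0 d0 Kx Kt]]] := HK y s Kys wy.
(* At the maximum the time derivative of [v] is nonnegative and its Laplacian nonpositive, while
   [v_t - Delta v = q - e < 0]. *)
have := heat_atB _ _ _ _ _ _ Hq (heat_atZ _ _ _ e _ (heat_at_time t0 y s)).
move=> [dt [dx [Ht Hx E]]].
have dt0 : 0 <= dt.
  by apply: is_derive_ge0_left_max Ht d0 _ => r r1 r2; apply: vmax; exact: Kt.
have dx0 : \sum_i dx i <= 0.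
  apply: sumr_le0 => i _; apply: (deriv2_at_le0 _ _ _ (Hx i)).
  apply: filterS (Kx i) => r Kr.
  by rewrite scale0r addr0; exact: vmax.
by move: E; lra.
Qed.

(** * Gaussian solutions and their pointwise bounds *)

(** The Euclidean square, as the heat kernel requires; the norm of a row vector is the sup norm. *)
Definition sqnorm {R : realType} {n : nat} (x : 'rV[R]_n) : R :=
  \sum_i x 0 i ^+ 2.

(* The heat kernel up to the factor [(4 pi)^(- n / 2)]. *)
Definition gauss {R : realType} {n : nat} (x : 'rV[R]_n) (s : R) : R :=
  (Num.sqrt s ^+ n)^-1 * expR (- (sqnorm x / (4 * s))).

Lemma sqnorm_ge0 {R : realType} {n : nat} (x : 'rV[R]_n) : 0 <= sqnorm x.
Proof. by apply: sumr_ge0 => i _; exact: sqr_ge0. Qed.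

Lemma continuous_sqnorm {R : realType} {n : nat} :
  continuous (@sqnorm R n).
Proof.
apply: continuous_big; first exact: add_continuous.
move=> i _ x; apply: (@cvg_comp _ _ _ (fun y : 'rV[R]_n => y 0 i)
  (fun s => s ^+ 2)); last exact: exprn_continuous.
exact: coord_continuous.
Qed.

Lemma sqnorm_slice {R : realType} {n : nat} (x : 'rV[R]_n) i (h : R) :
  sqnorm (x + h *: delta_mx 0 i) = sqnorm x + 2 * h * x 0 i + h ^+ 2.
Proof.
rewrite /sqnorm (bigD1 i) //= [\sum_j _](bigD1 i) //= !mxE !eqxx.
rewrite (eq_bigr (fun j => x 0 j ^+ 2)) /=; first by ring.
by move=> j ji; rewrite !mxE (negbTE ji) andbF mulr0 addr0.
Qed.

Lemma is_derive_expR_comp {R : realType} (f : R -> R) (a d : R) :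
  is_derive a (1 : R) f d ->
  is_derive a (1 : R) (fun s => expR (f s)) (expR (f a) * d).
Proof. by move=> H; exact: (is_derive1_comp (is_derive_expR (f a)) H). Qed.

Lemma deriv2_gauss {R : realType} (A y s C : R) : s != 0 ->
  deriv2_at (fun h => C * expR (- ((A + 2 * h * y + h ^+ 2) / (4 * s)))) 0
    (C * expR (- (A / (4 * s))) * ((y / (2 * s)) ^+ 2 - (2 * s)^-1)).
Proof.
move=> s0.
have D1 h : is_derive h (1 : R)
    (fun h => - ((A + 2 * h * y + h ^+ 2) / (4 * s))) (- ((y + h) / (2 * s))).
  have -> : (fun h => - ((A + 2 * h * y + h ^+ 2) / (4 * s))) =
    horner (- (4 * s)^-1 *: (A%:P + (2 * y) *: 'X + 'X^2)).
    by apply/funext => k; rewrite !hornerE; ring.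
  apply: is_derive_eq.
  by rewrite !(derivZ, derivD, derivC, derivX, derivXn) !hornerE /=; field.
exists (fun h => C * expR (- ((A + 2 * h * y + h ^+ 2) / (4 * s))) *
   (- ((y + h) / (2 * s)))).
  near=> h; rewrite -mulrA; apply: is_deriveZ; exact: is_derive_expR_comp.
have D2 : is_derive (0 : R) (1 : R) (fun h => - ((y + h) / (2 * s)))
    (- (2 * s)^-1).
  have -> : (fun h => - ((y + h) / (2 * s))) =
    horner (- (2 * s)^-1 *: (y%:P + 'X)).
    by apply/funext => k; rewrite !hornerE; ring.
  apply: is_derive_eq.
  by rewrite !(derivZ, derivD, derivC, derivX, derivXn) !hornerE /=; ring.
have := is_deriveM (is_deriveZ C (is_derive_expR_comp _ _ _ (D1 0))) D2.
rewrite /GRing.scale /= mulr0 mul0r expr0n /= !addr0 => H.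
by apply: is_derive_eq H _; rewrite /GRing.scale /=; field.
Unshelve. all: by end_near. Qed.

Lemma is_derive_gauss_time {R : realType} (n : nat) (A r t : R) : r < t ->
  is_derive t (1 : R)
    (fun s => (Num.sqrt (s - r) ^+ n)^-1 * expR (- (A / (4 * (s - r)))))
    ((Num.sqrt (t - r) ^+ n)^-1 * expR (- (A / (4 * (t - r)))) *
      (A / (4 * (t - r) ^+ 2) - n%:R / (2 * (t - r)))).
Proof.
move=> rt.
have D : is_derive t (1 : R) (fun s => s - r) 1.
  by rewrite -[X in is_derive _ _ _ X]subr0; apply: is_deriveB.
have tr0 : 0 < t - r by rewrite subr_gt0.
have sq0 : 0 < Num.sqrt (t - r) by rewrite sqrtr_gt0.
have E2 := @is_derive1_comp _ Num.sqrt (fun s => s - r) t _ _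
  (is_derive1_sqrt tr0) D.
have sqn0 : Num.sqrt (t - r) ^+ n != 0 by rewrite expf_neq0 // gt_eqF.
have E3 := is_deriveX n E2; rewrite exprfctE in E3.
have E4 := @is_deriveV _ (fun s => Num.sqrt (s - r) ^+ n) t _ _ sqn0 E3.
have tr1 : t - r != 0 by rewrite gt_eqF.
have E5 := is_derive_expR_comp _ _ _ (is_deriveZ (- (A / 4))
  (@is_deriveV _ (fun s => s - r) t _ _ tr1 D)).
have := is_deriveM E4 E5.
rewrite /GRing.scale /=.
have E s : - (A / (4 * (s - r))) = - (A / 4) * (s - r)^-1.
  by rewrite invfM mulrA mulNr.
set f := (fun s => (Num.sqrt (s - r) ^+ n)^-1) * _; set g := fun s => _.
have -> : f = g by apply/funext => s; rewrite /f /g /= E.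
move=> H; apply: is_derive_eq H _.
rewrite E /=; set X := expR _; set S := Num.sqrt _ in sq0 sqn0 *.
have tE : t - r = S ^+ 2 by rewrite /S sqr_sqrtr // ltW.
have S0 : S != 0 by rewrite gt_eqF.
rewrite tE; move: S0; clear; case: n => [|m] /= S0.
  by rewrite !expr0 mulr0n; field.
rewrite [S ^+ m.+1]exprS; set P := S ^+ m.
have P0 : P != 0 by rewrite expf_neq0.
by field; rewrite S0.
Qed.

Lemma heat_at_gauss {R : realType} {n : nat} (z x : 'rV[R]_n) (r t : R) :
  r < t -> heat_at (fun x t => gauss (x - z) (t - r)) x t 0.
Proof.
move=> rt; have tr0 : t - r != 0 by rewrite gt_eqF // subr_gt0.
eexists; exists (fun i => gauss (x - z) (t - r) *
  (((x - z) 0 i / (2 * (t - r))) ^+ 2 - (2 * (t - r))^-1)).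
split; first exact: is_derive_gauss_time.
- move=> i; rewrite /gauss.
  have := deriv2_gauss (sqnorm (x - z)) ((x - z) 0 i) (t - r)
    ((Num.sqrt (t - r) ^+ n)^-1) tr0.
  set f := fun _ => _; set g := fun _ => _; suff -> : f = g by [].
  by apply/funext => h; rewrite /f /g [x + _ - z]addrAC sqnorm_slice.
- rewrite -mulr_sumr -mulrBr sumrB sumr_const card_ord.
  rewrite (eq_bigr (fun i => (2 * (t - r)) ^- 2 * (x - z) 0 i ^+ 2)); last first.
    by move=> i _; rewrite expr_div_n mulrC.
  rewrite -mulr_sumr -/(sqnorm _) -mulr_natl.
  apply/esym/eqP; rewrite mulf_eq0; apply/orP; right; apply/eqP; field.
  by rewrite tr0.
Qed.

Lemma continuous_gauss {R : realType} {n : nat} (z x : 'rV[R]_n) (r t : R) :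
  r < t ->
  {for (x, t), continuous (fun p : 'rV[R]_n * R => gauss (p.1 - z) (p.2 - r))}.
Proof.
move=> rt; have tr0 : 0 < t - r by rewrite subr_gt0.
have c2 : (p.2 - r) @[p --> ((x, t) : 'rV[R]_n * R)] --> t - r.
  by apply: cvgB; [exact: cvg_snd|exact: cvg_cst].
apply: cvgM.
  apply: cvgV; first by rewrite expf_neq0 // gt_eqF // sqrtr_gt0.
  apply: (@cvg_comp _ _ _ (fun p : 'rV[R]_n * R => Num.sqrt (p.2 - r))
    (fun s => s ^+ n)); last exact: exprn_continuous.
  apply: (@cvg_comp _ _ _ (fun p : 'rV[R]_n * R => p.2 - r) Num.sqrt).
    exact: c2.
  exact: sqrt_continuous.
apply: (@cvg_comp _ _ _ (fun p : 'rV[R]_n * R =>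
  - (sqnorm (p.1 - z) / (4 * (p.2 - r)))) expR); last exact: continuous_expR.
apply: cvgN; apply: cvgM; last first.
  apply: cvgV; first by rewrite mulf_neq0 // gt_eqF.
  by apply: cvgM; [exact: cvg_cst|exact: c2].
apply: (@cvg_comp _ _ _ (fun p : 'rV[R]_n * R => p.1 - z) sqnorm); last first.
  exact: continuous_sqnorm.
by apply: cvgB; [exact: cvg_fst|exact: cvg_cst].
Qed.

Lemma exprn_le_expR {R : realType} (n : nat) (q : R) :
  0 <= q -> q ^+ n <= expR (n%:R * (q - 1)).
Proof.
move=> q0; rewrite expRM_natl lerXn2r ?nnegrE ?expR_ge0 //.
by have := expR_ge1Dx (q - 1); lra.
Qed.

Lemma gauss_le {R : realType} {n : nat} (y : 'rV[R]_n) (s : R) :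
  0 < s -> gauss y s <= (Num.sqrt s ^+ n)^-1.
Proof.
move=> s0; rewrite /gauss ler_piMr ?invr_ge0 ?exprn_ge0 ?sqrtr_ge0 //.
by rewrite expR_le1 oppr_le0 divr_ge0 ?sqnorm_ge0 // mulr_ge0 // ltW.
Qed.

Lemma gauss_ge0 {R : realType} {n : nat} (y : 'rV[R]_n) (s : R) :
  0 <= gauss y s.
Proof. by rewrite mulr_ge0 ?expR_ge0 // invr_ge0 exprn_ge0 // sqrtr_ge0. Qed.

(** Narrowing by the factor [K = 4 * n%:R + 4] multiplies the prefactor by [K ^+ n] and, as
    [l ^+ 2 <= sqnorm y], lowers the exponent by at least [(K ^+ 2 - 1) / 4]. This [K] satisfies
    [1 + n (K - 1) <= (K ^+ 2 - 1) / 4], so the decay beats both the prefactor and the factor 2. *)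
Lemma gauss_narrow_le {R : realType} {n : nat} (y : 'rV[R]_n) (l : R) :
  0 < l -> l ^+ 2 <= sqnorm y ->
  gauss y ((l / (4 * n%:R + 4)) ^+ 2) <= 2^-1 * gauss y (l ^+ 2).
Proof.
move=> l0 ly; have n0 : 0 <= n%:R :> R by [].
set K : R := 4 * n%:R + 4; have K0 : 0 < K by rewrite /K; lra.
rewrite /gauss !sqrtr_sqr !gtr0_norm ?divr_gt0 //.
rewrite expr_div_n invf_div -mulrA mulrCA mulrA [leRHS]mulrCA -mulrA.
rewrite ler_pM2l ?invr_gt0 ?exprn_gt0 //.
set A := sqnorm y.
have -> : A / (4 * (l / K) ^+ 2) = A * (K ^+ 2 - 1) / (4 * l ^+ 2) +
    A / (4 * l ^+ 2).
  by field; rewrite !gt_eqF.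
rewrite opprD expRD mulrA; apply: ler_wpM2r; first exact: expR_ge0.
rewrite expRN ler_pdivrMr ?expR_gt0 //.
rewrite -ler_pdivrMl ?invr_gt0 // invrK.
have H1 := exprn_le_expR n K (ltW K0).
have H2 : 2 <= expR 1 :> R by have := @expR_ge1Dx R 1; lra.
apply: (@le_trans _ _ (expR (1 + n%:R * (K - 1)))).
  by rewrite expRD ler_pM // exprn_ge0 // ltW.
rewrite ler_expR ler_pdivlMr; last by rewrite mulr_gt0 // exprn_gt0.
have K1 : 0 <= K ^+ 2 - 1 by rewrite /K; nra.
apply: (@le_trans _ _ (l ^+ 2 * (K ^+ 2 - 1))); last by rewrite ler_wpM2r.
have l2 : 0 <= l ^+ 2 by exact: sqr_ge0.
have -> : (1 + n%:R * (K - 1)) * (4 * l ^+ 2) =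
  l ^+ 2 * (4 * (1 + n%:R * (K - 1))) by ring.
by apply: ler_wpM2l => //; rewrite /K; nra.
Qed.

(** With [q = sqrt (S / s) >= 1], the Gaussian is at most [q ^+ n * expR (- ((n%:R + 3) * q ^+ 2))]
    over [Num.sqrt S ^+ n]; the summand 3 pays for the 8, as [8 <= expR 3]. *)
Lemma gauss_far_le {R : realType} {n : nat} (y : 'rV[R]_n) (s S : R) :
  0 < s -> s <= S -> 4 * (n%:R + 3) * S <= sqnorm y ->
  gauss y s <= (8 * Num.sqrt S ^+ n)^-1.
Proof.
move=> s0 sS yS; have S0 : 0 < S by exact: lt_le_trans sS.
have n0 : 0 <= n%:R :> R by [].
pose q := Num.sqrt S / Num.sqrt s.
have sq0 : 0 < Num.sqrt s by rewrite sqrtr_gt0.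
have Sq0 : 0 < Num.sqrt S by rewrite sqrtr_gt0.
have q1 : 1 <= q by rewrite ler_pdivlMr // mul1r ler_wsqrtr.
have E : S / s = q ^+ 2 by rewrite /q expr_div_n !sqr_sqrtr // ltW.
have H1 := exprn_le_expR n q (le_trans ler01 q1).
have H2 : 8 <= expR 3 :> R.
  have := @exprn_le_expR R 3 2 ltac:(by []); have -> : (2 : R) - 1 = 1 by ring.
  by rewrite mulr1; lra.
have H3 : expR (- (sqnorm y / (4 * s))) <= expR (- ((n%:R + 3) * q ^+ 2)).
  rewrite ler_expR lerN2 -E ler_pdivlMr ?mulr_gt0 //.
  apply: le_trans yS; rewrite le_eqVlt; apply/orP; left; apply/eqP; field.
  by rewrite gt_eqF.
have H4 : q ^+ n * 8 <= expR ((n%:R + 3) * q ^+ 2).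
  apply: (@le_trans _ _ (expR (n%:R * (q - 1) + 3))).
    by rewrite expRD ler_pM // exprn_ge0 // ltW // (lt_le_trans ltr01).
  have q2 : q <= q ^+ 2 by rewrite expr2 ler_peMl // (le_trans ler01).
  have := ler_wpM2l n0 q2; rewrite ler_expR mulrDl mulrBr mulr1; lra.
rewrite /gauss.
have -> : (Num.sqrt s ^+ n)^-1 = q ^+ n / Num.sqrt S ^+ n.
  rewrite /q expr_div_n mulrAC divff ?mul1r //.
  by rewrite expf_neq0 // gt_eqF.
rewrite [in leRHS]invfM [leLHS]mulrAC ler_pM2r ?invr_gt0 ?exprn_gt0 //.
apply: (le_trans (ler_wpM2l _ H3)); first by rewrite exprn_ge0 // ltW // (lt_le_trans ltr01).
by rewrite expRN ler_pdivrMr ?expR_gt0 // ler_pdivlMl // mulrC.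
Qed.

(** Within distance [sqrt s] the exponential is at least 3/4, so subtracting half of the wider
    Gaussian leaves a quarter of [s^(-n/2)], which is at least twice the constant subtracted
    next. *)
Lemma gauss_near_ge {R : realType} {n : nat} (y : 'rV[R]_n) (s s' S : R) :
  0 < s -> s <= s' -> s' <= S -> sqnorm y <= s ->
  (8 * Num.sqrt S ^+ n)^-1 <=
  gauss y s - 2^-1 * gauss y s' - (8 * Num.sqrt S ^+ n)^-1.
Proof.
move=> s0 ss' s'S ys; have s'0 : 0 < s' by exact: lt_le_trans ss'.
have sq0 : 0 < Num.sqrt s by rewrite sqrtr_gt0.
have mono (a b : R) : 0 < a -> a <= b ->
    (Num.sqrt b ^+ n)^-1 <= (Num.sqrt a ^+ n)^-1.
  move=> a0 ab; have b0 : 0 < b by exact: lt_le_trans ab.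
  rewrite lef_pV2 ?posrE ?exprn_gt0 ?sqrtr_gt0 //.
  by rewrite lerXn2r ?nnegrE ?sqrtr_ge0 // ler_wsqrtr.
have H1 := mono _ _ s0 ss'.
have H2 := mono _ _ s'0 s'S.
have H3 := gauss_le y s' s'0.
have H4 : (Num.sqrt s ^+ n)^-1 * (3 / 4) <= gauss y s.
  rewrite /gauss ler_wpM2l ?invr_ge0 ?exprn_ge0 ?sqrtr_ge0 //.
  apply: le_trans (expR_ge1Dx _).
  have : sqnorm y / (4 * s) <= 4^-1.
    by rewrite ler_pdivrMr ?mulr_gt0 //; lra.
  by lra.
by rewrite invfM; lra.
Qed.

(** * Cubes, quadratic barriers and the interior Lipschitz bound *)

Definition cube {R : realType} {n : nat} (z : 'rV[R]_n) (rho : R) : set 'rV[R]_n :=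
  [set x | forall i, `|x 0 i - z 0 i| <= rho].

Lemma compact_cube {R : realType} {n : nat} (z : 'rV[R]_n) (rho : R) :
  compact (cube z rho).
Proof.
have := @rV_compact R n (fun i => `[z 0 i - rho, z 0 i + rho]%classic)
  (fun i => @segment_compact R _ _).
set A := mkset _; suff -> : cube z rho = A by [].
by apply/seteqP; split => x H i; have := H i; rewrite /= in_itv /= ler_distl.
Qed.

Lemma compact_cylinder {R : realType} {n : nat} (z : 'rV[R]_n) (rho a b : R) :
  compact (cube z rho `*` `[a, b]).
Proof. by apply: compact_setX; [exact: compact_cube|exact: segment_compact]. Qed.

Lemma near_cube_slice {R : realType} {n : nat} (z x : 'rV[R]_n) (rho : R) i :
  cube z rho x -> `|x 0 i - z 0 i| < rho ->
  \forall s \near (0 : R), cube z rho (x + s *: delta_mx 0 i).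
Proof.
move=> Hx Hi; apply/nbhs_ballP; exists (rho - `|x 0 i - z 0 i|) => /=.
  by rewrite subr_gt0.
move=> s; rewrite /ball /= sub0r normrN => Hs j; rewrite !mxE eqxx /=.
have [->|ji] := eqVneq j i; last by rewrite mulr0 addr0.
rewrite mulr1 addrAC; apply: (le_trans (ler_normD _ _)); lra.
Qed.

Lemma le_sqnorm {R : realType} {n : nat} (x : 'rV[R]_n) i :
  x 0 i ^+ 2 <= sqnorm x.
Proof. by rewrite /sqnorm (bigD1 i) //= lerDl sumr_ge0 // => j _; exact: sqr_ge0. Qed.

Lemma deriv2_quadratic {R : realType} (a b c : R) :
  deriv2_at (fun h => a + b * h + c * h ^+ 2) 0 (2 * c).
Proof.
exists (fun h => b + 2 * c * h).
  near=> h.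
  have -> : (fun h => a + b * h + c * h ^+ 2) =
    horner (a%:P + b *: 'X + c *: 'X^2).
    by apply/funext => k; rewrite !hornerE.
  apply: is_derive_eq.
  by rewrite !(derivZ, derivD, derivC, derivX, derivXn) !hornerE /=; ring.
have -> : (fun h => b + 2 * c * h) = horner (b%:P + (2 * c) *: 'X).
  by apply/funext => k; rewrite !hornerE.
apply: is_derive_eq.
by rewrite !(derivZ, derivD, derivC, derivX, derivXn) !hornerE /=; ring.
Unshelve. all: by end_near. Qed.

Lemma heat_at_sqnorm {R : realType} {n : nat} (z x : 'rV[R]_n) (t : R) :
  heat_at (fun x _ => sqnorm (x - z)) x t (- (2 * n%:R)).
Proof.
exists 0, (fun=> 2); split; first exact: is_derive_cst.
- move=> i.
  have := deriv2_quadratic (sqnorm (x - z)) (2 * (x - z) 0 i) 1.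
  rewrite mulr1; set f := fun _ => _; set g := fun _ => _.
  suff -> : f = g by [].
  apply/funext => h; rewrite /f /g [x + _ - z]addrAC sqnorm_slice; ring.
- by rewrite sumr_const card_ord sub0r -[2 *+ n]mulr_natr.
Qed.

Lemma heat_at_coord {R : realType} {n : nat} (z x : 'rV[R]_n) i (b c t : R) :
  heat_at (fun x _ => b * (x 0 i - z 0 i) + c * (x 0 i - z 0 i) ^+ 2) x t
    (- (2 * c)).
Proof.
exists 0, (fun j => if j == i then 2 * c else 0); split.
- exact: is_derive_cst.
- move=> j; have [->|ji] := eqVneq j i.
    set y := x 0 i - z 0 i.
    have := deriv2_quadratic (b * y + c * y ^+ 2) (b + 2 * c * y) c.
    set f := fun _ => _; set g := fun _ => _; suff -> : f = g by [].
    by apply/funext => h; rewrite /f /g !mxE !eqxx /= /y; ring.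
  set g := fun _ => _; have -> : g = cst (g 0); last exact: deriv2_at_cst.
  apply/funext => h; rewrite /g /= !mxE [i == j]eq_sym (negbTE ji) andbF.
  by rewrite !mulr0.
- by rewrite -big_mkcond /= big_pred1_eq sub0r.
Qed.

Lemma cvg_reflect_coord {R : realType} {n : nat} {T : Type}
    (F : set_system T) {FF : Filter F} (f : T -> 'rV[R]_n) (y : 'rV[R]_n)
    (i : 'I_n) (a : R) :
  f x @[x --> F] --> y ->
  reflect_coord i a (f x) @[x --> F] --> reflect_coord i a y.
Proof.
move=> fy; apply: cvgD; first exact: fy.
apply: cvgZ; last exact: cvg_cst.
apply: cvgM; first exact: cvg_cst.
apply: cvgB; first exact: cvg_cst.
exact: (cvg_comp _ (fun z : 'rV[R]_n => z 0 i) fy (@coord_continuous R 1 n 0 i y)).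
Qed.

Lemma reflect_coordE {R : realType} {n : nat} (i j : 'I_n) (a : R)
    (x : 'rV[R]_n) :
  reflect_coord i a x 0 j = if j == i then 2 * a - x 0 j else x 0 j.
Proof.
rewrite /reflect_coord !mxE eqxx /=; case: eqVneq => [->|_].
  by rewrite mulr1; ring.
by rewrite mulr0 addr0.
Qed.

(* The difference of [u] and its reflection in the hyperplane midway between the
   two points vanishes on that hyperplane; on the half cylinder it is compared
   with a quadratic barrier whose concave term in the normal direction absorbs
   the bound on the source. *)
Lemma coord_lipschitz {R : realType} {n : nat} (u : 'rV[R]_n -> R -> R)
    (z : 'rV[R]_n) (t1 r G B : R) :
  0 < r -> 0 <= G -> 0 <= B ->
  (forall x t, cube z r x -> t1 - r ^+ 2 <= t -> t <= t1 ->
    [/\ 0 <= u x t, u x t <= G,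
        {for (x, t), continuous (fun p : 'rV[R]_n * R => u p.1 p.2)}
      & exists2 q, heat_at u x t q & 0 <= q <= B * G / r ^+ 2]) ->
  forall x i h, cube z (r / 4) x -> cube z (r / 4) (x + h *: delta_mx 0 i) ->
  u x t1 - u (x + h *: delta_mx 0 i) t1 <= 4 * (n%:R + 1 + B) * G * `|h| / r.
Proof.
move=> r0 G0 B0 Hu x i h xz xhz.
set k := n%:R + 1 + B.
have n0 : 0 <= n%:R :> R by [].
have k1 : 1 <= k by rewrite /k; lra.
pose d := r / 4; have d0 : 0 < d by rewrite /d; lra.
have rd : r = 4 * d by rewrite /d; lra.
pose m := x + (h / 2) *: delta_mx 0 i.
pose a := m 0 i.
have mi : a = x 0 i + h / 2 by rewrite /a /m !mxE !eqxx mulr1.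
have mz j : `|m 0 j - z 0 j| <= d.
  have := xz j; have := xhz j; rewrite -/d !mxE eqxx /=.
  case: (j == i); rewrite ?mulr1 ?mulr0 ?addr0 // !ler_norml.
  by move=> /andP[? ?] /andP[? ?]; apply/andP; split; lra.
(* [eps] is the sign of [- h]; it puts [x] on the nonnegative side of the mirror. *)
pose eps : R := if h <= 0 then 1 else -1.
have eps2 : eps * eps = 1 by rewrite /eps; case: ifP => _; ring.
have epsh : eps * (- h) = `|h|.
  rewrite /eps; case: ifPn => [h0|]; first by rewrite ler0_norm // mul1r.
  by rewrite -ltNge => h0; rewrite gtr0_norm //; ring.
pose K : set ('rV[R]_n * R) :=
  (cube m d `*` `[t1 - d ^+ 2, t1]) `&`
  [set p : 'rV[R]_n * R | 0 <= eps * (p.1 0 i - a)].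
have KP p s : K (p, s) -> [/\ cube m d p, t1 - d ^+ 2 <= s, s <= t1,
    0 <= eps * (p 0 i - a) & [/\ cube z r p, cube z r (reflect_coord i a p)
    & t1 - r ^+ 2 <= s]].
  move=> [[/= pm /=]]; rewrite in_itv /= => /andP[s1 s2] pe; split => //.
  split.
  - move=> j; have := pm j; have := mz j; rewrite !ler_norml rd.
    by move=> /andP[? ?] /andP[? ?]; apply/andP; split; lra.
  - move=> j; have := pm j; have := mz j; rewrite reflect_coordE !ler_norml rd.
    move=> /andP[? ?] /andP[? ?]; case: eqVneq => [ji|_]; last first.
      by apply/andP; split; lra.
    by rewrite /a -ji; apply/andP; split; lra.
  - by apply: le_trans s1; rewrite lerD2l lerN2 rd; nra.
have cK : compact K.
  apply: compact_closedI; first exact: compact_cylinder.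
  have cf : continuous (fun p : 'rV[R]_n * R => eps * (p.1 0 i - a)).
    move=> p; apply: cvgM; first exact: cvg_cst.
    apply: cvgB; last exact: cvg_cst.
    apply: (cvg_comp (fun p : 'rV[R]_n * R => p.1) (fun y : 'rV[R]_n => y 0 i)).
      exact: cvg_fst.
    exact: coord_continuous.
  exact: (@preimage_closed _ _ _ [set y : R | 0 <= y] (fun p _ => cf p)
    (@closed_ge R 0)).
(* In units of [d], the barrier is [G] times the squared distance plus the time before [t1], which
   reaches [G] on the lateral faces and at the bottom, plus [k (2 y - y^2)], which is nonnegative on
   [K] and zero on the mirror. With [k = n + 1 + B] its heat operator equals [(1 + 2 B) G / d^2],
   above the source bound. *)
pose V (p : 'rV[R]_n) (s : R) := G / d ^+ 2 * sqnorm (p - m)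
  - G / d ^+ 2 * (s - t1)
  + (2 * k * eps * G / d * (p 0 i - m 0 i)
     + - (k * G / d ^+ 2) * (p 0 i - m 0 i) ^+ 2).
pose w p s := u p s - u (reflect_coord i a p) s - V p s.
have VE p s : V p s = G * (sqnorm (p - m) / d ^+ 2 + (t1 - s) / d ^+ 2 +
   k * (2 * (eps * (p 0 i - a) / d) - (eps * (p 0 i - a) / d) ^+ 2)).
  rewrite /V -/a.
  have -> : (eps * (p 0 i - a) / d) ^+ 2 = (p 0 i - a) ^+ 2 / d ^+ 2.
    by rewrite expr_div_n exprMn (expr2 eps) eps2 mul1r.
  by field; rewrite gt_eqF.
suff Hw : w x t1 <= 0.
  have E : reflect_coord i a x = x + h *: delta_mx 0 i.
    by rewrite /reflect_coord mi; congr (_ + _ *: _); field.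
  move: Hw; rewrite /w E subr_le0 => /le_trans; apply.
  rewrite VE subrr mul0r addr0 mi.
  have -> : eps * (x 0 i - (x 0 i + h / 2)) = `|h| / 2.
    by rewrite -epsh; field.
  have -> : sqnorm (x - m) = (`|h| / 2) ^+ 2.
    have -> : x - m = 0 + (- (h / 2)) *: delta_mx 0 i.
      by rewrite /m opprD addNKr add0r scaleNr.
    rewrite sqnorm_slice /sqnorm big1 ?mxE; last by move=> j _; rewrite mxE expr0n.
    by rewrite mulr0 !add0r sqrrN !expr_div_n real_normK // num_real.
  rewrite rd; set c := `|h|.
  have -> : 4 * k * G * c / (4 * d) = G * (k * (2 * (c / 2 / d))).
    by field; rewrite gt_eqF.
  apply: ler_wpM2l => //.
  (* Since [k >= 1], the two squares together are nonpositive and only the linear term is left. *)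
  rewrite -expr_div_n mulrBr; set e := c / 2 / d.
  have : e ^+ 2 <= k * e ^+ 2 by rewrite ler_peMl // sqr_ge0.
  by lra.
have Kx : K (x, t1).
  split; last first.
    rewrite /= mi; have -> : eps * (x 0 i - (x 0 i + h / 2)) = eps * (- h) / 2.
      by field.
    by rewrite epsh divr_ge0.
  split; last first.
    by rewrite /= in_itv /= lexx andbT lerBlDr lerDl sqr_ge0.
  move=> j; rewrite !mxE eqxx /=.
  case: eqVneq => [->|_]; last by rewrite mulr0 addr0 subrr normr0 ltW.
  rewrite mulr1 opprD addNKr normrN.
  have := xz i; have := xhz i; rewrite -/d !mxE !eqxx /= mulr1 !ler_norml.
  by move=> /andP[? ?] /andP[? ?]; apply/andP; split; lra.
apply: (weak_max_principle K w (t1 - d ^+ 2) cK _ _ _ x t1 Kx).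
- move=> [p s] /KP[_ s1 s2 _ [pz pz' s3]].
  have [_ _ cu _] := Hu p s pz s3 s2.
  have [_ _ cu' _] := Hu _ s pz' s3 s2.
  apply: cvgB.
    apply: cvgB; first exact: cu.
    apply: (cvg_comp (fun p : 'rV[R]_n * R => (reflect_coord i a p.1, p.2))
      (fun p : 'rV[R]_n * R => u p.1 p.2)); last exact: cu'.
    have cr : (fun q : 'rV[R]_n * R => reflect_coord i a q.1) @ (p, s) -->
        reflect_coord i a p.
      by apply: cvg_reflect_coord; exact: cvg_fst.
    have cs : (fun q : 'rV[R]_n * R => q.2) @ (p, s) --> s by exact: cvg_snd.
    exact: cvg_pair cr cs.
  have ci : (fun q : 'rV[R]_n * R => q.1 0 i - m 0 i) @ (p, s) -->
      p 0 i - m 0 i.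
    apply: cvgB; last exact: cvg_cst.
    apply: (cvg_comp (fun p : 'rV[R]_n * R => p.1) (fun y : 'rV[R]_n => y 0 i)).
      exact: cvg_fst.
    exact: coord_continuous.
  apply: cvgD; first apply: cvgB.
  + apply: cvgM; first exact: cvg_cst.
    apply: (cvg_comp (fun q : 'rV[R]_n * R => q.1 - m) sqnorm).
      by apply: cvgB; [exact: cvg_fst|exact: cvg_cst].
    exact: continuous_sqnorm.
  + apply: cvgM; first exact: cvg_cst.
    by apply: cvgB; [exact: cvg_snd|exact: cvg_cst].
  + apply: cvgD; first by apply: cvgM; [exact: cvg_cst|exact: ci].
    apply: cvgM; first exact: cvg_cst.
    apply: (cvg_comp (fun q : 'rV[R]_n * R => q.1 0 i - m 0 i)
      (fun s => s ^+ 2)); first exact: ci.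
    exact: exprn_continuous.
- by move=> [p s] /KP[].
move=> p s Kps w0; have [pm s1 s2 pe [pz pz' s3]] := KP _ _ Kps.
have [up0 upG _ [q1 Hq1 /andP[q10 q11]]] := Hu p s pz s3 s2.
have [up0' upG' _ [q2 Hq2 /andP[q20 q21]]] := Hu _ s pz' s3 s2.
set y := eps * (p 0 i - a) in pe *.
have yd : y / d <= 1.
  rewrite ler_pdivrMr // mul1r; have := pm i; rewrite -/a.
  apply: le_trans; apply: (le_trans (ler_norm _)); rewrite normrM.
  by rewrite /eps; case: ifP => _; rewrite ?normrN normr1 mul1r.
have yd0 : 0 <= y / d by rewrite divr_ge0 // ltW.
have ypart : 0 <= k * (2 * (y / d) - (y / d) ^+ 2).
  by apply: mulr_ge0; [lra|nra].
have sq0 := sqnorm_ge0 (p - m).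
have d2 : 0 < d ^+ 2 by rewrite exprn_gt0.
have sp0 : 0 <= (t1 - s) / d ^+ 2 by rewrite divr_ge0 ?subr_ge0 // ltW.
have sq1 : 0 <= sqnorm (p - m) / d ^+ 2 by rewrite divr_ge0 // ltW.
(* As [u] takes values between 0 and [G], [w > 0] forces [V < G], which keeps the point off the
   lateral faces and the bottom; it is off the mirror because [w <= 0] there. *)
have Vlt : V p s < G.
  by move: w0; rewrite /w; lra.
have Gpos : 0 < G.
  rewrite lt_neqAle G0 andbT; apply/eqP => G00.
  by move: Vlt; rewrite VE -G00 mul0r ltxx.
move: Vlt; rewrite VE -/y gtr_pMr // => Vlt.
have sqd : sqnorm (p - m) < d ^+ 2.
  by have : sqnorm (p - m) / d ^+ 2 < 1 by [lra]; rewrite ltr_pdivrMr // mul1r.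
have st : t1 - s < d ^+ 2.
  by have : (t1 - s) / d ^+ 2 < 1 by [lra]; rewrite ltr_pdivrMr // mul1r.
have y0 : 0 < y.
  rewrite lt_neqAle pe andbT; apply/eqP => y00.
  have pia : p 0 i = a.
    have : eps * y = p 0 i - a by rewrite /y mulrA eps2 mul1r.
    by rewrite -y00 mulr0 => /eqP; rewrite eq_sym subr_eq0 => /eqP.
  have E : reflect_coord i a p = p.
    by rewrite /reflect_coord pia subrr mulr0 scale0r addr0.
  move: w0; rewrite /w E subrr sub0r oppr_gt0 VE -/y.
  by rewrite ltNge; apply/negP; rewrite negbK; apply: mulr_ge0 => //; lra.
have HV := heat_atD _ _ _ _ _ _ (heat_atB _ _ _ _ _ _
   (heat_atZ _ _ _ (G / d ^+ 2) _ (heat_at_sqnorm m p s))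
   (heat_atZ _ _ _ (G / d ^+ 2) _ (heat_at_time t1 p s)))
   (heat_at_coord m p i (2 * k * eps * G / d) (- (k * G / d ^+ 2)) s).
have Hw := heat_atB _ _ _ _ _ _ (heat_atB _ _ _ _ _ _ Hq1
  (heat_at_reflect _ _ _ _ _ _ Hq2)) HV.
eexists; exists (s - (t1 - d ^+ 2)); split; first exact: Hw.
- have -> : G / d ^+ 2 * - (2 * n%:R) - G / d ^+ 2 * 1 - 2 * - (k * G / d ^+ 2) =
    (1 + 2 * B) * (G / d ^+ 2) by rewrite /k; ring.
  have E : B * G / r ^+ 2 = B / 16 * (G / d ^+ 2).
    by rewrite rd; field; rewrite gt_eqF.
  have : B / 16 * (G / d ^+ 2) <= (1 + 2 * B) * (G / d ^+ 2).
    by apply: ler_wpM2r; [rewrite divr_ge0 // ltW|lra].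
  by rewrite -E; lra.
- by lra.
- move=> j; have pj : `|p 0 j - m 0 j| < d.
    rewrite -ltr_sqr ?nnegrE ?(ltW d0) // real_normK ?num_real //.
    by apply: le_lt_trans sqd; have := le_sqnorm (p - m) j; rewrite !mxE.
  have := near_cube_slice _ _ _ j pm pj => H1.
  have H2 : \forall h \near (0 : R), `|h| < y.
    by apply/nbhs_ballP; exists y => //= b; rewrite /ball /= sub0r normrN.
  apply: filterS2 H1 H2 => b Hb1 Hb2; split; first by split => //; case: Kps => -[].
  rewrite /= !mxE eqxx /=.
  case: (i == j); last by rewrite mulr0 addr0.
  rewrite mulr1 addrAC mulrDr -/y; have : `|eps * b| < y.
    by rewrite normrM /eps; case: ifP => _; rewrite ?normrN normr1 mul1r.
  by rewrite ltr_norml; lra.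
- move=> c c1 c2; case: Kps => -[/= pm' /=]; rewrite in_itv /= => /andP[s1' s2'] pe'.
  split => //; split => //=; rewrite in_itv /=; apply/andP; split; lra.
Qed.

Lemma cube_normE {R : realType} {n : nat} (z x : 'rV[R]_n) (rho : R) :
  0 <= rho -> cube z rho x <-> `|x - z| <= rho.
Proof.
move=> rho0; rewrite [`|_|]mx_normrE; split => [H|/bigmax_leP[_ H] i].
  by apply/bigmax_leP; split => // -[i j] _ /=; rewrite ord1 !mxE; exact: H.
by have := H (0, i) isT; rewrite !mxE.
Qed.

(** The coordinates of [z] are replaced by those of [x] one at a time; each change costs one
    application of [coord_lipschitz], and [delta <= 4^-1] keeps the path in the cube where it
    applies. *)
Lemma cube_lower_bound {R : realType} {n : nat} (u : 'rV[R]_n -> R -> R)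
    (z : 'rV[R]_n) (t1 r G B delta : R) :
  0 < r -> 0 <= G -> 0 <= B -> 0 <= delta -> delta <= 4^-1 ->
  (forall x t, cube z r x -> t1 - r ^+ 2 <= t -> t <= t1 ->
    [/\ 0 <= u x t, u x t <= G,
        {for (x, t), continuous (fun p : 'rV[R]_n * R => u p.1 p.2)}
      & exists2 q, heat_at u x t q & 0 <= q <= B * G / r ^+ 2]) ->
  forall x, cube z (delta * r) x ->
  u z t1 - n%:R * (4 * (n%:R + 1 + B) * G * delta) <= u x t1.
Proof.
move=> r0 G0 B0 d0 d4 Hu x Hx.
have dr : delta * r <= r / 4 by rewrite mulrC ler_pM2l.
pose y (m : nat) : 'rV[R]_n := \row_j (if (j < m)%N then x 0 j else z 0 j).
have yc m : cube z (r / 4) (y m).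
  move=> j; rewrite mxE; case: ifP => _; last by rewrite subrr normr0; lra.
  by apply: le_trans dr; exact: Hx.
suff H m : (m <= n)%N ->
    u z t1 - m%:R * (4 * (n%:R + 1 + B) * G * delta) <= u (y m) t1.
  have -> : x = y n by apply/rowP => j; rewrite mxE ltn_ord.
  exact: H.
elim: m => [_|m IH mn].
  have -> : y 0%N = z by apply/rowP => j; rewrite mxE.
  by rewrite mul0r subr0.
pose i := Ordinal mn.
have yS : y m.+1 = y m + (x 0 i - z 0 i) *: delta_mx 0 i.
  apply/rowP => j; rewrite !mxE eqxx /= ltnS leq_eqVlt.
  have [->|ji] := eqVneq j i; first by rewrite eqxx ltnn /= mulr1 addrCA subrr addr0.
  have -> : (j == m :> nat) = false by apply/negbTE; exact: ji.
  by rewrite mulr0 addr0.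
have yc' : cube z (r / 4) (y m + (x 0 i - z 0 i) *: delta_mx 0 i).
  by rewrite -yS; exact: yc.
have := coord_lipschitz u z t1 r G B r0 G0 B0 Hu (y m) i _ (yc m) yc'.
rewrite -yS; have := IH (ltnW mn).
have : 4 * (n%:R + 1 + B) * G * `|x 0 i - z 0 i| / r <=
    4 * (n%:R + 1 + B) * G * delta.
  rewrite -mulrA; apply: ler_wpM2l; last by rewrite ler_pdivrMr.
  have n0 : 0 <= n%:R :> R by [].
  by rewrite mulr_ge0 //; lra.
by rewrite -natr1 mulrDl mul1r; lra.
Qed.

(** * Concentration near points of large value *)

(** The exponent is critical: a height [a ^+ n] becomes that height divided by the square of the
    length [1 / a], as parabolic scaling demands. *)
Lemma powR_critical {R : realType} (n : nat) (a : R) : (1 <= n)%N -> 0 <= a ->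
  (a ^+ n) `^ (1 + 2 / n%:R) = a ^+ n.+2.
Proof.
move=> n1 a0; rewrite -powR_mulrn // -powRrM mulrDr mulr1.
have -> : n%:R + n%:R * (2 / n%:R) = n.+2%:R :> R.
  by rewrite mulrCA divff ?mulr1 -?natrD ?addn2 // pnatr_eq0 -lt0n.
by rewrite powR_mulrn.
Qed.

(** Here [delta] is chosen from [n] and [b] before [u] and the point, so the mass under every bump
    has the same lower bound; [lambda] only makes [r] small against [sqrt t0]. *)
Lemma concentration {R : realType} {n : nat} (b : R) : (1 <= n)%N -> 0 < b ->
  exists delta : R, 0 < delta <= 1 /\
  forall (u : 'rV[R]_n -> R -> R) (x0 : 'rV[R]_n) (t0 lambda : R),
  0 < t0 -> 4 <= lambda -> (lambda / Num.sqrt t0) ^+ n <= u x0 t0 ->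
  (forall x t, cube x0 (Num.sqrt t0 / 2) x -> 3 / 4 * t0 <= t -> t <= t0 ->
    [/\ 0 <= u x t, {for (x, t), continuous (fun p : 'rV[R]_n * R => u p.1 p.2)}
      & exists2 q, heat_at u x t q &
          0 <= q <= b * (u x t + 1 / Num.sqrt t ^+ n) `^ (1 + 2 / n%:R)]) ->
  exists x1 t1 r, [/\ cube x0 (Num.sqrt t0 / 2) x1, 3 / 4 * t0 <= t1 <= t0,
    0 < r, r <= Num.sqrt t0 / lambda
    & forall x, cube x1 (delta * r) x -> (r ^+ n)^-1 / 2 <= u x t1].
Proof.
move=> n1 b0; have n1' : 1 <= n%:R :> R by rewrite ler1n.
(* On the cylinder found below, [u + t^(-n/2) <= 2 G <= (4 / r)^n] with [G = 2^n / r^n]; this [B]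
   makes [b (4 / r)^(n+2)] equal to [B G / r^2]. *)
pose B := b * 4 ^+ n.+2 / 2 ^+ n.
have pow2 : 2 <= 2 ^+ n :> R by rewrite -{1}[2]expr1 ler_weXn2l // ler1n.
have B0 : 0 < B.
  by apply: divr_gt0; [apply: mulr_gt0 => //|]; apply: exprn_gt0; lra.
(* [D] makes the total loss in [cube_lower_bound], taken with [delta = 1 / D], equal to half of the
   value at the maximum point. *)
pose D := 8 * n%:R * (n%:R + 1 + B) * 2 ^+ n.
have D4 : 4 <= D.
  have H : 1 <= n%:R * (n%:R + 1 + B) by rewrite mulr_ege1 //; lra.
  have : 1 <= n%:R * (n%:R + 1 + B) * 2 ^+ n by rewrite mulr_ege1 //; lra.
  by rewrite /D -!mulrA; lra.
exists D^-1; split.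
  by rewrite invr_gt0 invf_le1; [apply/andP; split; lra|lra].
move=> u x0 t0 lambda t00 lam4 ux0 Hu.
set S := Num.sqrt t0 in ux0 Hu *.
have S0 : 0 < S by rewrite sqrtr_gt0.
have S2 : S ^+ 2 = t0 by rewrite sqr_sqrtr // ltW.
pose rho := S / 2; have rho0 : 0 < rho by rewrite /rho; lra.
have rho2 : rho ^+ 2 = t0 / 4 by rewrite /rho expr_div_n S2; field.
pose a := t0 - rho ^+ 2; have aE : a = 3 / 4 * t0 by rewrite /a rho2; field.
(* Parabolic distance to the lateral faces and the bottom of [Q]. Where it is at least half of its
   value at a maximum point of [u * zeta ^+ n], [u] is at most [2 ^+ n] times its value at that
   point. *)
pose zeta (p : 'rV[R]_n * R) := Num.min (rho - `|p.1 - x0|) (Num.sqrt (p.2 - a)).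
pose Q := cube x0 rho `*` `[a, t0].
have cQ : compact Q by exact: compact_cylinder.
have Q0 : Q (x0, t0).
  split => /=; first by move=> j; rewrite subrr normr0 ltW.
  by rewrite in_itv /= lexx andbT /a gerBl sqr_ge0.
have czeta : continuous zeta.
  move=> p; apply: (@continuous_min R _ (fun p : 'rV[R]_n * R => rho - `|p.1 - x0|)
    (fun p => Num.sqrt (p.2 - a)) p).
    apply: cvgB; first exact: cvg_cst.
    apply: (cvg_comp (fun p : 'rV[R]_n * R => p.1 - x0) (fun y : 'rV[R]_n => `|y|)).
      by apply: cvgB; [exact: cvg_fst|exact: cvg_cst].
    exact: norm_continuous.
  apply: (cvg_comp (fun p : 'rV[R]_n * R => p.2 - a) Num.sqrt).
    by apply: cvgB; [exact: cvg_snd|exact: cvg_cst].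
  exact: sqrt_continuous.
have cf : {within Q, continuous (fun p => u p.1 p.2 * zeta p ^+ n)}.
  apply: continuous_in_subspaceT => -[x t] /set_mem [/= Qx].
  rewrite in_itv /= => /andP[t1 t2].
  have [|_ cu _] := Hu x t Qx _ t2; first by rewrite -aE.
  apply: cvgM; first exact: cu.
  apply: (cvg_comp zeta (fun s => s ^+ n)); first exact: czeta.
  exact: exprn_continuous.
have [[x1 t1] /set_mem Q1 Hmax] :=
  compact_EVT_max (ex_intro _ _ Q0 : Q !=set0) cQ cf.
have Hmax' x t : Q (x, t) ->
    u x t * zeta (x, t) ^+ n <= u x1 t1 * zeta (x1, t1) ^+ n.
  by move=> Qx; have := Hmax (x, t); apply; exact: mem_set.
have {Hmax} := Hmax' x0 t0 Q0.
have -> : zeta (x0, t0) = rho.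
  rewrite /zeta /= subrr normr0 subr0 /a opprB addrCA subrr addr0.
  by rewrite sqrtr_sqr gtr0_norm // minxx.
set z1 := zeta (x1, t1); set M := u x1 t1 => HM.
have {}HM : (lambda / 2) ^+ n <= M * z1 ^+ n.
  apply: le_trans HM; apply: le_trans (ler_wpM2r _ ux0); last first.
    by rewrite exprn_ge0 // ltW.
  rewrite -exprMn /rho; have -> : lambda / S * (S / 2) = lambda / 2.
    by field; rewrite gt_eqF.
  exact: lexx.
move: Q1 => [/= Qx1]; rewrite in_itv /= => /andP[at1 t10].
have x1n : `|x1 - x0| <= rho by apply/cube_normE => //; exact: ltW.
have z1a : z1 <= rho - `|x1 - x0| by rewrite /z1 /zeta ge_min lexx.
have z1b : z1 <= Num.sqrt (t1 - a) by rewrite /z1 /zeta ge_min lexx orbT.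
have z1ge0 : 0 <= z1 by rewrite /z1 /zeta le_min subr_ge0 x1n sqrtr_ge0.
have lam0 : 0 < (lambda / 2) ^+ n by rewrite exprn_gt0 //; lra.
have z10 : 0 < z1.
  rewrite lt_neqAle z1ge0 andbT; apply/eqP => z1E.
  by move: HM; rewrite -z1E expr0n eqn0Ngt n1 mulr0 leNgt lam0.
have M0 : 0 < M.
  by move: (lt_le_trans lam0 HM); rewrite pmulr_lgt0 // exprn_gt0.
(* The length for which [M = r^-n]. The maximum property gives [lambda r <= 2 z1], hence
   [r <= z1 / 2] as [lambda >= 4], and the backward cylinder of size [r] stays where
   [zeta >= z1 / 2]. *)
pose r := M `^ (- n%:R^-1).
have r0 : 0 < r by rewrite powR_gt0.
have rn : r ^+ n = M^-1.
  rewrite -powR_mulrn ?ltW // -powRrM mulNr mulVf ?powR_inv1 ?ltW //.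
  by rewrite pnatr_eq0 -lt0n.
have rz : lambda / 2 <= z1 / r.
  rewrite -(@ler_pXn2r _ n) ?nnegrE //; [|lra|by rewrite divr_ge0 // ltW].
  by rewrite [leRHS]expr_div_n rn invrK (mulrC _ M).
have rz2 : r <= z1 / 2.
  move: rz; rewrite ler_pdivlMr // => rz.
  have : 2 * r <= lambda / 2 * r by apply: ler_wpM2r; [exact: ltW|lra].
  by lra.
have rS : r <= S / lambda.
  move: rz; rewrite ler_pdivlMr // => rz; rewrite ler_pdivlMr; last by lra.
  by have := normr_ge0 (x1 - x0); move: z1a; rewrite /rho; lra.
exists x1, t1, r; split => //; first by rewrite -aE at1.
have ME : M = (r ^+ n)^-1 by rewrite rn invrK.
pose G := 2 ^+ n / r ^+ n.
have GM : G = 2 ^+ n * M by rewrite /G -ME.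
have G0 : 0 <= G by rewrite divr_ge0 // exprn_ge0 // ltW.
have Hcyl x t : cube x1 r x -> t1 - r ^+ 2 <= t -> t <= t1 ->
    [/\ 0 <= u x t, u x t <= G,
        {for (x, t), continuous (fun p : 'rV[R]_n * R => u p.1 p.2)}
      & exists2 q, heat_at u x t q & 0 <= q <= B * G / r ^+ 2].
  move=> /cube_normE xr tr tt1; have {}xr := xr (ltW r0).
  have xx0 : `|x - x0| <= rho - z1 / 2.
    have : `|x - x0| <= `|x - x1| + `|x1 - x0|.
      by apply: le_trans (ler_normD _ _); rewrite addrA subrK.
    by lra.
  have ta : (z1 / 2) ^+ 2 <= t - a.
    have : z1 ^+ 2 <= t1 - a.
      rewrite -[leRHS]sqr_sqrtr; last by rewrite subr_ge0.
      by rewrite lerXn2r // nnegrE ?sqrtr_ge0.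
    have : r ^+ 2 <= (z1 / 2) ^+ 2 by rewrite lerXn2r ?nnegrE //; lra.
    by have := sqr_ge0 z1; rewrite expr_div_n; lra.
  have Qxc : cube x0 rho x by apply/cube_normE; [exact: ltW|lra].
  have at' : a <= t by have := sqr_ge0 (z1 / 2); lra.
  have tt0 : t <= t0 by lra.
  have Qx : Q (x, t) by split => //=; rewrite in_itv /= at'.
  have zx : z1 / 2 <= zeta (x, t).
    rewrite /zeta le_min /=; apply/andP; split; first by lra.
    rewrite -[leLHS]gtr0_norm; last by lra.
    by rewrite -sqrtr_sqr ler_wsqrtr.
  have [|ux cu [q Hq /andP[q0 qb]]] := Hu x t Qxc _ tt0; first by rewrite -aE.
  have uG : u x t <= G.
    have : u x t * (z1 / 2) ^+ n <= M * z1 ^+ n.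
      apply: le_trans (Hmax' x t Qx); apply: ler_wpM2l => //.
      by rewrite lerXn2r ?nnegrE //; lra.
    rewrite expr_div_n mulrA ler_pdivrMr ?exprn_gt0 // mulrAC.
    by rewrite ler_pM2r ?exprn_gt0 // GM mulrC.
  split => //; exists q => //; rewrite q0 /=; apply: le_trans qb _.
  have tS : S / 2 <= Num.sqrt t.
    rewrite -[leLHS]gtr0_norm; last by lra.
    by rewrite -sqrtr_sqr ler_wsqrtr // -/rho rho2; lra.
  have Srt : r / 2 <= Num.sqrt t.
    apply: le_trans tS; move: rz2 z1a; rewrite /rho.
    by have := normr_ge0 (x1 - x0); lra.
  (* The singular term obeys the same bound as [u], since [r / 2 <= sqrt t]. *)
  have H1 : 1 / Num.sqrt t ^+ n <= G.
    rewrite div1r /G -expr_div_n -exprVn.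
    rewrite lerXn2r ?nnegrE ?invr_ge0 ?sqrtr_ge0 ?divr_ge0 ?(ltW r0) //.
    rewrite -invf_div lef_pV2 ?posrE ?divr_gt0 //.
    by apply: lt_le_trans Srt; rewrite divr_gt0.
  have -> : B * G / r ^+ 2 = b * (4 / r) ^+ n.+2.
    rewrite /B /G expr_div_n [r ^+ n.+2]exprSr [r ^+ n.+1]exprSr; field.
    by rewrite !expf_neq0 ?gt_eqF.
  apply: ler_wpM2l; first exact: ltW.
  rewrite -powR_critical //; last by rewrite divr_ge0 // ltW.
  apply: ge0_ler_powR.
  - by rewrite addr_ge0 // divr_ge0 // ler0n.
  - by rewrite nnegrE addr_ge0 // divr_ge0 // exprn_ge0 // sqrtr_ge0.
  - by rewrite nnegrE exprn_ge0 // divr_ge0 // ltW.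
  - apply: (@le_trans _ _ (2 * G)); first by lra.
    have -> : (4 / r) ^+ n = 2 ^+ n * G.
      by rewrite /G mulrA -exprMn -expr_div_n; congr ((_ / _) ^+ _); ring.
    exact: ler_wpM2r.
move=> x Hx.
have D0 : 0 < D by lra.
have := cube_lower_bound u x1 t1 r G B D^-1 r0 G0 (ltW B0) _ _ Hcyl x Hx.
rewrite invr_ge0 (ltW D0) lef_pV2 ?posrE // => /(_ isT D4).
rewrite -ME -/M; apply: le_trans.
have -> : n%:R * (4 * (n%:R + 1 + B) * G / D) = M / 2.
  rewrite GM /D; field; rewrite expf_neq0 // pnatr_eq0 -lt0n n1 andbT /=.
  by rewrite gt_eqF //; lra.
by lra.
Qed.

(* Subtracting half of a wider Gaussian makes the initial value nonpositive
   outside the ball of radius [l] and costs only half of the mass; subtracting [h]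
   makes the bump nonpositive at a fixed distance from [z] for a short time. *)
Definition heat_bump {R : realType} {n : nat} (h : R) (z : 'rV[R]_n) (t1 l : R)
    (x : 'rV[R]_n) (t : R) : R :=
  gauss (x - z) (t - (t1 - (l / (4 * n%:R + 4)) ^+ 2)) -
  2^-1 * gauss (x - z) (t - (t1 - l ^+ 2)) - h.

(** * Size, sign and decay of a single bump *)

Section bump_theory.
Context {R : realType} {n : nat}.
Variables (h : R) (z : 'rV[R]_n) (t1 l : R).
Hypotheses (h0 : 0 <= h) (l0 : 0 < l).

Let K : R := 4 * n%:R + 4.

Let K1 : 1 <= K.
Proof. by have : 0 <= n%:R :> R by []; rewrite /K; lra. Qed.

Let lK0 : 0 < l / K.
Proof. by rewrite divr_gt0 // (lt_le_trans ltr01). Qed.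

Let lK2 : 0 < (l / K) ^+ 2.
Proof. by rewrite exprn_gt0. Qed.

Let l2 : (l / K) ^+ 2 <= l ^+ 2.
Proof.
rewrite lerXn2r ?nnegrE ?(ltW lK0) ?(ltW l0) // ler_pdivrMr.
  by rewrite ler_peMr // ltW.
exact: lt_le_trans ltr01 K1.
Qed.

Let lt_narrow t : t1 <= t -> t1 - (l / K) ^+ 2 < t.
Proof. by have := lK2; lra. Qed.

Let lt_wide t : t1 <= t -> t1 - l ^+ 2 < t.
Proof. by have := lK2; have := l2; lra. Qed.

Lemma heat_at_bump x t : t1 <= t -> heat_at (heat_bump h z t1 l) x t 0.
Proof.
move=> t1t.
have Ha := heat_at_gauss z x _ t (lt_narrow t t1t).
have Hb := heat_at_gauss z x _ t (lt_wide t t1t).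
have := heat_atB _ _ _ _ _ _ (heat_atB _ _ _ _ _ _ Ha
  (heat_atZ _ _ _ 2^-1 _ Hb)) (heat_at_cst h x t).
by rewrite mulr0 !subr0.
Qed.

Lemma continuous_bump x t : t1 <= t ->
  {for (x, t), continuous (fun p : 'rV[R]_n * R => heat_bump h z t1 l p.1 p.2)}.
Proof.
move=> t1t; apply: cvgB; last exact: cvg_cst.
apply: cvgB; first by apply: continuous_gauss; exact: lt_narrow.
apply: cvgM; first exact: cvg_cst.
by apply: continuous_gauss; exact: lt_wide.
Qed.

Let bump_le_gauss x t : heat_bump h z t1 l x t <= gauss (x - z) (t - (t1 - (l / K) ^+ 2)).
Proof.
by rewrite /heat_bump -/K; have := gauss_ge0 (x - z) (t - (t1 - l ^+ 2)); have := h0; lra.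
Qed.

Lemma bump_initial_le x : heat_bump h z t1 l x t1 <= (K / l) ^+ n.
Proof.
apply: le_trans (bump_le_gauss _ _) _.
have -> : t1 - (t1 - (l / K) ^+ 2) = (l / K) ^+ 2 by ring.
by apply: le_trans (gauss_le _ _ lK2) _; rewrite sqrtr_sqr gtr0_norm // -exprVn invf_div.
Qed.

Lemma bump_initial_le0 x : l ^+ 2 <= sqnorm (x - z) -> heat_bump h z t1 l x t1 <= 0.
Proof.
move=> lx; rewrite /heat_bump -/K.
have -> : t1 - (t1 - (l / K) ^+ 2) = (l / K) ^+ 2 by ring.
have -> : t1 - (t1 - l ^+ 2) = l ^+ 2 by ring.
by have := gauss_narrow_le (x - z) l l0 lx; rewrite -/K; have := h0; lra.
Qed.

(** Uniform in [l]: the narrow Gaussian has age at least [t - t1] at time [t], however concentrated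
    it was at [t1]. *)
Lemma bump_decay x t : t1 < t -> heat_bump h z t1 l x t <= (Num.sqrt (t - t1) ^+ n)^-1.
Proof.
move=> t1t; apply: le_trans (bump_le_gauss _ _) _.
have tt : 0 < t - t1 by rewrite subr_gt0.
have tK : t - t1 <= t - (t1 - (l / K) ^+ 2) by have := lK2; lra.
have tK0 := lt_le_trans tt tK.
apply: le_trans (gauss_le _ _ tK0) _.
rewrite lef_pV2 ?posrE ?exprn_gt0 ?sqrtr_gt0 //.
by rewrite lerXn2r ?nnegrE ?sqrtr_ge0 // ler_wsqrtr.
Qed.

Lemma bump_lateral_le0 S x t : h = (8 * Num.sqrt S ^+ n)^-1 ->
  t1 <= t -> t - t1 + l ^+ 2 <= S -> 4 * (n%:R + 3) * S <= sqnorm (x - z) ->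
  heat_bump h z t1 l x t <= 0.
Proof.
move=> hE t1t tS xS.
have s0 : 0 < t - (t1 - (l / K) ^+ 2) by rewrite subr_gt0; exact: lt_narrow.
have sS : t - (t1 - (l / K) ^+ 2) <= S by have := l2; lra.
have := gauss_far_le (x - z) _ S s0 sS xS; rewrite -hE.
by rewrite /heat_bump -/K; have := gauss_ge0 (x - z) (t - (t1 - l ^+ 2));
  have := h0; lra.
Qed.

(** The [h] that removes the bump far from [z] is also left over near [z], for every admissible [l]
    and [t1]: this is what a unit bump contributes at the observation point. *)
Lemma bump_final_ge S x t : h = (8 * Num.sqrt S ^+ n)^-1 ->
  t1 <= t -> t - t1 + l ^+ 2 <= S -> sqnorm (x - z) <= t - t1 ->
  h <= heat_bump h z t1 l x t.
Proof.
move=> hE t1t tS xS; rewrite /heat_bump -/K hE.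
by apply: gauss_near_ge; have := l2; have := lK2; lra.
Qed.

End bump_theory.

(** * Comparison with [u] and superposition of bumps *)

(** The maximum principle for [w - u]: by the lateral and initial hypotheses, a point where it is
    positive is off the lateral faces and later than [s], so it has the room required. *)
Lemma heat_comparison {R : realType} {n : nat} (u w : 'rV[R]_n -> R -> R)
    (z : 'rV[R]_n) (rho s T : R) :
  (forall x t, cube z rho x -> s <= t -> t <= T ->
    [/\ {for (x, t), continuous (fun p : 'rV[R]_n * R => u p.1 p.2)},
        {for (x, t), continuous (fun p : 'rV[R]_n * R => w p.1 p.2)}
      & exists p q, [/\ heat_at w x t p, heat_at u x t q & p <= q]]) ->
  (forall x t i, cube z rho x -> s <= t -> t <= T -> `|x 0 i - z 0 i| = rho ->
    w x t <= u x t) ->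
  (forall x, cube z rho x -> w x s <= u x s) ->
  forall x t, cube z rho x -> s <= t -> t <= T -> w x t <= u x t.
Proof.
move=> Hreg Hlat Hinit x t xz st tT.
pose K := cube z rho `*` `[s, T].
rewrite -subr_le0.
apply: (weak_max_principle K (fun x t => w x t - u x t) s
  (compact_cylinder _ _ _ _)).
- move=> [y r] [/= yz]; rewrite in_itv /= => /andP[sr rT].
  by have [cu cw _] := Hreg y r yz sr rT; apply: cvgB; [exact: cw|exact: cu].
- by move=> [y r] [/= _]; rewrite in_itv /= => /andP[].
- move=> y r [/= yz]; rewrite in_itv /= => /andP[sr rT]; rewrite subr_gt0 => wu.
  have [_ _ [p [q [Hp Hq pq]]]] := Hreg y r yz sr rT.
  exists (p - q), (r - s); split; first exact: heat_atB.
  + by rewrite subr_le0.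
  + rewrite subr_gt0 lt_neqAle sr andbT; apply: contraTneq wu => <-.
    by rewrite -leNgt; exact: Hinit.
  + move=> i; have yi : `|y 0 i - z 0 i| < rho.
      rewrite lt_neqAle yz andbT; apply: contraTneq wu => yi.
      by rewrite -leNgt; exact: (Hlat y r i).
    apply: filterS (near_cube_slice _ _ _ _ yz yi) => h Hh.
    by split => //=; rewrite in_itv /= sr.
  + move=> c c1 c2; split => //=; rewrite in_itv /=; apply/andP; split; lra.
- by split => //=; rewrite in_itv /= st.
Qed.


(* [w] is a superposition of [k] bumps emitted before time [s] and lying below
   [u] at that time; [c] is the mass of a bump and [h] bounds from below what a
   unit mass contributes at the point [(z, T)]. *)
Definition bump_stack {R : realType} {n : nat} (u : 'rV[R]_n -> R -> R)
    (z : 'rV[R]_n) (rho T c h : R) (k : nat) (s : R) (w : 'rV[R]_n -> R -> R) :=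
  [/\ forall x t, cube z rho x -> s <= t -> t <= T -> heat_at w x t 0 /\
        {for (x, t), continuous (fun p : 'rV[R]_n * R => w p.1 p.2)},
      forall x t i, cube z rho x -> s <= t -> t <= T ->
        `|x 0 i - z 0 i| = rho -> w x t <= 0,
      forall x t, s < t -> w x t <= k%:R * c / Num.sqrt (t - s) ^+ n,
      forall x, cube z rho x -> w x s <= u x s
    & k%:R * (c * h) <= w z T].

Lemma bump_stack_le {R : realType} {n : nat} (u : 'rV[R]_n -> R -> R)
    (z : 'rV[R]_n) (rho T c h : R) k s w :
  (forall x t, cube z rho x -> s <= t -> t <= T ->
    [/\ 0 <= u x t, {for (x, t), continuous (fun p : 'rV[R]_n * R => u p.1 p.2)}
      & exists2 q, heat_at u x t q & 0 <= q]) ->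
  bump_stack u z rho T c h k s w ->
  forall x t, cube z rho x -> s <= t -> t <= T -> w x t <= u x t.
Proof.
move=> Hu [H1 H2 _ H4 _]; apply: heat_comparison => //.
- move=> x t xz st tT; have [_ cu [q Hq q0]] := Hu x t xz st tT.
  by have [Hw cw] := H1 x t xz st tT; split => //; exists 0, q.
- move=> x t i xz st tT xi; apply: le_trans (H2 x t i xz st tT xi) _.
  by have [] := Hu x t xz st tT.
Qed.

(** A bump emitted at [t1] fits under [u] once there is room for its peak on the cube of radius [l]
    about [y], because outside that cube it is nonpositive at time [t1]. *)
Lemma bump_stackS {R : realType} {n : nat} (u : 'rV[R]_n -> R -> R)
    (z y : 'rV[R]_n) (rho T c h : R) k s w (t1 l : R) :
  0 < rho -> 0 <= c -> 0 < l -> s < t1 -> 0 < t1 -> t1 <= T -> l ^+ 2 <= t1 ->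
  0 <= h -> h = (8 * Num.sqrt (2 * T) ^+ n)^-1 ->
  32 * (n%:R + 3) * T <= rho ^+ 2 ->
  cube z (rho / 2) y -> sqnorm (z - y) <= T - t1 ->
  (forall x, cube z rho x -> w x t1 <= u x t1) ->
  (forall x, cube z rho x -> cube y l x ->
    w x t1 + c * ((4 * n%:R + 4) / l) ^+ n <= u x t1) ->
  bump_stack u z rho T c h k s w ->
  bump_stack u z rho T c h k.+1 t1
    (fun x t => w x t + c * heat_bump h y t1 l x t).
Proof.
move=> rho0 c0 l0 st1 t10 t1T lt1 h0 hE Trho yz yn Hfar Hnear [H1 H2 H3 H4 H5].
have neg x t : heat_bump h y t1 l x t <= 0 -> c * heat_bump h y t1 l x t <= 0.
  by move=> ?; rewrite mulr_ge0_le0.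
have sq_ge i (d : R) (x x' : 'rV[R]_n) : 0 <= d -> d <= `|x 0 i - x' 0 i| ->
    d ^+ 2 <= sqnorm (x - x').
  move=> d0 dx; apply: le_trans (le_sqnorm _ i).
  by rewrite !mxE -[leRHS]real_normK ?num_real // lerXn2r ?nnegrE.
split.
- move=> x t xz tt1 tT; have [Hw cw] := H1 x t xz (ltW (lt_le_trans st1 tt1)) tT.
  split; last first.
    apply: cvgD; first exact: cw.
    by apply: cvgM; [exact: cvg_cst|exact: continuous_bump].
  have := heat_atD _ _ _ _ _ _ Hw (heat_atZ _ _ _ c _
    (heat_at_bump h y t1 l l0 x t tt1)).
  by rewrite mulr0 addr0.
- move=> x t i xz tt1 tT xi.
  have Hw := H2 x t i xz (ltW (lt_le_trans st1 tt1)) tT xi.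
  suff /neg Hb : heat_bump h y t1 l x t <= 0 by lra.
  (* The scale [2 * T] exceeds [t - t1 + l ^+ 2], and [y] is at least [rho / 2] away from the
     lateral faces, whence the size required of [rho ^+ 2]. *)
  apply: (bump_lateral_le0 h y t1 l h0 l0 (2 * T)) => //; first by lra.
  apply: (@le_trans _ _ ((rho / 2) ^+ 2)).
    by rewrite expr_div_n; lra.
  apply: (sq_ge i); first by rewrite divr_ge0 // ltW.
  have := yz i; have : rho <= `|x 0 i - y 0 i| + `|y 0 i - z 0 i|.
    by rewrite -xi; apply: le_trans (ler_normD _ _); rewrite addrA subrK.
  by lra.
- move=> x t tt1; have Hw := H3 x t (lt_trans st1 tt1).
  have Hb := ler_wpM2l c0 (bump_decay h y t1 l h0 l0 x t tt1).
  have : k%:R * c / Num.sqrt (t - s) ^+ n <= k%:R * c / Num.sqrt (t - t1) ^+ n.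
    apply: ler_wpM2l; first by rewrite mulr_ge0.
    rewrite lef_pV2 ?posrE ?exprn_gt0 ?sqrtr_gt0 ?subr_gt0 ?(lt_trans st1) //.
    by rewrite lerXn2r ?nnegrE ?sqrtr_ge0 // ler_wsqrtr // lerD2l lerN2 ltW.
  by rewrite -natr1 !mulrDl mul1r; lra.
- move=> x xz; have [Hx|Hx] := pselect (cube y l x).
    apply: le_trans (Hnear x xz Hx); rewrite lerD2l.
    exact: (ler_wpM2l c0 (bump_initial_le h y t1 l h0 l0 x)).
  have wu := Hfar x xz; suff /neg Hb : heat_bump h y t1 l x t1 <= 0 by lra.
  have [i Hi] : exists i, ~ `|x 0 i - y 0 i| <= l by exact/existsNP.
  apply: bump_initial_le0 => //; apply: (sq_ge i); first exact: ltW.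
  by rewrite leNgt; apply/negP => /ltW.
- have : h <= heat_bump h y t1 l z T.
    by apply: (bump_final_ge h y t1 l l0 (2 * T)) => //; lra.
  move=> /(ler_wpM2l c0).
  by rewrite -natr1 mulrDl mul1r; lra.
Qed.

(** * The local bound, by contradiction *)

(** The constants are fixed in this order: [delta], the observation time [T0], the mass [c] of a
    bump, its unit contribution [h], a number [N] of bumps whose total exceeds [u z T0], and last
    [lam], which makes each new point dominate up to [N] earlier bumps. *)
Lemma local_bound {R : realType} {n : nat} (b T rho : R) (z : 'rV[R]_n)
    (u : 'rV[R]_n -> R -> R) :
  (1 <= n)%N -> 0 < b -> 0 < T -> 0 < rho ->
  (forall x t, cube z rho x -> 0 < t -> t < T ->
    [/\ 0 <= u x t, {for (x, t), continuous (fun p : 'rV[R]_n * R => u p.1 p.2)}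
      & exists2 q, heat_at u x t q &
          0 <= q <= b * (u x t + 1 / Num.sqrt t ^+ n) `^ (1 + 2 / n%:R)]) ->
  exists C eta : R, 0 < eta /\ forall x t, cube z eta x -> 0 < t -> t < eta ->
    u x t <= C / Num.sqrt t ^+ n.
Proof.
move=> n1 b0 T_gt0 rho0 Hu.
have n0 : 1 <= n%:R :> R by rewrite ler1n.
have [delta [/andP[delta0 delta1] Hconc]] := @concentration R n b n1 b0.
have [T0 [T00 T0T T0rho]] : exists T0 : R,
    [/\ 0 < T0, T0 < T & 32 * (n%:R + 3) * T0 <= rho ^+ 2].
  have d0 : 0 < 32 * (n%:R + 3) :> R by lra.
  have D0 : 0 < rho ^+ 2 / (32 * (n%:R + 3)) by rewrite divr_gt0 ?exprn_gt0.
  exists (Num.min (T / 2) (rho ^+ 2 / (32 * (n%:R + 3)))).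
  split; first by rewrite lt_min D0 divr_gt0.
    by rewrite gt_min ltr_pdivrMr ?ltr_pMr ?ltr1n.
  by rewrite mulrC -ler_pdivlMr // ge_min lexx orbT.
pose kap : R := 4 * n%:R + 4; have kap0 : 0 < kap by rewrite /kap; lra.
(* A bump of mass [c] and width [delta * r] has height at most a quarter of [r^-n], half of the
   lower bound that [concentration] provides. *)
have [c [c0 cE]] : exists c, 0 < c /\ forall r, 0 < r ->
    c * (kap / (delta * r)) ^+ n = (r ^+ n)^-1 / 4.
  exists ((delta / kap) ^+ n / 4); split => [|r r0].
    by rewrite divr_gt0 // exprn_gt0 // divr_gt0.
  rewrite mulrAC -exprMn.
  have -> : delta / kap * (kap / (delta * r)) = r^-1.
    by field; rewrite !gt_eqF.
  by rewrite exprVn.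
pose h := (8 * Num.sqrt (2 * T0) ^+ n)^-1.
have h0 : 0 < h by rewrite invr_gt0 mulr_gt0 // exprn_gt0 // sqrtr_gt0 mulr_gt0.
have [N HN] : exists N : nat, u z T0 < N%:R * (c * h).
  have ch0 : 0 < c * h by rewrite mulr_gt0.
  exists (Num.trunc (`|u z T0| / (c * h))).+1.
  rewrite -ltr_pdivrMr //; apply: le_lt_trans (truncnS_gt _).
  by rewrite ler_pM2r ?invr_gt0 // ler_norm.
(* Hence [N c / (sqrt t0 / 2)^n], which bounds the heat from earlier bumps, is at most a quarter of
   [(lam / sqrt t0)^n]. *)
have [lam [lam4 lamn]] : exists lam, 4 <= lam /\
    4 * (N%:R * c) * 2 ^+ n <= lam ^+ n.
  have m0 : 0 <= 4 * (N%:R * c) * 2 ^+ n.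
    by rewrite mulr_ge0 ?exprn_ge0 // mulr_ge0 // mulr_ge0 // ltW.
  exists (4 + 4 * (N%:R * c) * 2 ^+ n); split; first by rewrite lerDl.
  set m := 4 * (N%:R * c) * 2 ^+ n in m0 *.
  apply: (@le_trans _ _ ((4 + m) ^+ 1)); first by rewrite expr1 lerDr.
  by rewrite ler_weXn2l //; clear -m0; lra.
apply: contrapT => Hno.
have Hbad eta : 0 < eta -> exists x t, [/\ cube z eta x, 0 < t, t < eta
    & (lam / Num.sqrt t) ^+ n <= u x t].
  move=> eta0; apply: contrapT => Hx; apply: Hno.
  exists (lam ^+ n), eta; split => // x t xz t0 te.
  rewrite leNgt; apply/negP => ux; apply: Hx; exists x, t; split => //.
  by rewrite expr_div_n ltW.
have HP k s w : 0 < s -> bump_stack u z rho T0 c h k s w ->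
    forall x t, cube z rho x -> s <= t -> t <= T0 -> w x t <= u x t.
  move=> s0; apply: bump_stack_le => x t xz st tT.
  have [ux cu [q Hq /andP[q0 _]]] :=
    Hu x t xz (lt_le_trans s0 st) (le_lt_trans tT T0T).
  by split => //; exists q.
(* Stacks of [k] bumps are claimed at arbitrarily small times: the latest bump is located first,
   near time [t0], and all earlier ones must then be placed before [t0 / 4]. *)
suff H k : (k <= N)%N -> forall eta, 0 < eta ->
    exists s w, [/\ 0 < s, s < eta, s < T0 & bump_stack u z rho T0 c h k s w].
  have [s [w [s0 sT _ Hw]]] := H N (leqnn _) T0 T00.
  have zz : cube z rho z by move=> i; rewrite subrr normr0 ltW.
  have wu := HP N s w s0 Hw z T0 zz (ltW sT) (lexx _).
  by case: Hw => _ _ _ _; clear -wu HN; lra.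
elim: k => [_ eta eta0|k IH kN eta eta0].
  have [s [s0 se sT]] : exists s, [/\ 0 < s, s < eta & s < T0].
    exists (Num.min eta T0 / 2).
    have m0 : 0 < Num.min eta T0 by rewrite lt_min eta0.
    by split; rewrite ?divr_gt0 // ltr_pdivrMr // gt_min !ltr_pMr ?ltr1n // orbT.
  exists s, (fun _ _ => 0); split => //; split => //.
  - by move=> x t _ _ _; split; [exact: heat_at_cst|exact: cvg_cst].
  - by move=> x t _; rewrite !mul0r.
  - by move=> x xz; have [] := Hu x s xz s0 (lt_trans sT T0T).
  - by rewrite mul0r.
(* [e] keeps the new centre within [rho / 2] of [z] and, through [n e^2 <= T0 / 2], close enough for
   the bump to be felt at [(z, T0)]. *)
have [e [e0 erho en]] : exists e, [/\ 0 < e, e <= rho / 2 &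
    n%:R * e ^+ 2 <= T0 / 2].
  have n20 : 0 < 2 * n%:R :> R by clear -n0; lra.
  have T0n : 0 < T0 / (2 * n%:R) by rewrite divr_gt0.
  have e0 : 0 < Num.min (rho / 2) (Num.sqrt (T0 / (2 * n%:R))).
    by rewrite lt_min sqrtr_gt0 T0n divr_gt0.
  exists (Num.min (rho / 2) (Num.sqrt (T0 / (2 * n%:R)))); split => //.
    by rewrite ge_min lexx.
  have -> : T0 / 2 = n%:R * Num.sqrt (T0 / (2 * n%:R)) ^+ 2.
    rewrite sqr_sqrtr ?(ltW T0n) //; field.
    by rewrite gt_eqF // (lt_le_trans ltr01).
  by rewrite ler_wpM2l // lerXn2r ?nnegrE ?sqrtr_ge0 ?(ltW e0) // ge_min lexx orbT.
have [eta1 [eta10 e1 e2 e3 e4]] : exists eta1, [/\ 0 < eta1, eta1 <= eta,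
    eta1 <= e / 2, eta1 <= e ^+ 2 & eta1 <= T0 / 4].
  exists (Num.min (Num.min eta (e / 2)) (Num.min (e ^+ 2) (T0 / 4))).
  by split; rewrite ?lt_min ?eta0 ?exprn_gt0 ?divr_gt0 // !ge_min lexx ?orbT.
have [x0 [t0 [xz0 t00 te0 ux0]]] := Hbad eta1 eta10.
have t0T : t0 < T0 / 4 by exact: lt_le_trans e4.
have St0 : 0 < Num.sqrt t0 by rewrite sqrtr_gt0.
have Ste : Num.sqrt t0 <= e.
  rewrite -[leRHS]gtr0_norm // -sqrtr_sqr ler_wsqrtr //.
  exact: ltW (lt_le_trans te0 e3).
have sub0 x i : cube x0 (Num.sqrt t0 / 2) x -> `|x 0 i - z 0 i| <= e.
  move=> xx0; have -> : x 0 i - z 0 i = (x 0 i - x0 0 i) + (x0 0 i - z 0 i).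
    by rewrite addrA subrK.
  apply: le_trans (ler_normD _ _) _.
  by have := xx0 i; have := xz0 i; clear -e2 Ste; lra.
have [|x1 [t1 [r [xx1 /andP[t1a t1b] r0 rS Hlow]]]] :=
  Hconc u x0 t0 lam t00 lam4 ux0.
  move=> x t xx ta tb; apply: Hu.
  - move=> i; apply: (le_trans (sub0 x i xx)).
    by clear -erho rho0; lra.
  - by clear -t00 ta; lra.
  - by clear -t0T T0T T00 tb; lra.
have l0 : 0 < delta * r by rewrite mulr_gt0.
have lS : delta * r <= Num.sqrt t0 / lam.
  by apply: le_trans rS; rewrite ler_piMl // ltW.
have l2 : (delta * r) ^+ 2 <= t1.
  apply: (@le_trans _ _ ((Num.sqrt t0 / 4) ^+ 2)).
    rewrite lerXn2r ?nnegrE ?divr_ge0 ?(ltW l0) ?(ltW St0) //.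
    apply: (le_trans lS); rewrite ler_pM2l // lef_pV2 ?posrE //.
    by rewrite (lt_le_trans _ lam4).
  by rewrite expr_div_n sqr_sqrtr ?(ltW t00) //; clear -t00 t1a; lra.
have t10 : 0 < t1 by clear -t00 t1a; lra.
have t1T0 : t1 <= T0 / 4 by exact: le_trans t1b (ltW t0T).
have t04 : 0 < t0 / 4 by rewrite divr_gt0.
have [s [w [s0 st _ Hw]]] := IH (ltnW kN) _ t04.
have st1 : s < t1 by clear -st t1a t00; lra.
have t1T : t1 < T0 by clear -t1T0 T00; lra.
exists t1, (fun x t => w x t + c * heat_bump h x1 t1 (delta * r) x t); split => //.
  exact: (le_lt_trans t1b (lt_le_trans te0 e1)).
have wu x : cube z rho x -> w x t1 <= u x t1.
  by move=> xz; apply: (HP k s w s0 Hw) (ltW st1) (ltW t1T).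
apply: (bump_stackS _ _ _ _ _ _ _ _ s) => //; try exact: ltW.
- by move=> i; apply: le_trans (sub0 x1 i xx1) erho.
- apply: (@le_trans _ _ (n%:R * e ^+ 2)); last by clear -en t1T0 T00; lra.
  have -> : n%:R * e ^+ 2 = \sum_(i < n) e ^+ 2.
    by rewrite sumr_const card_ord mulr_natl.
  apply: ler_sum => i _; rewrite !mxE -[leLHS]real_normK ?num_real //.
  by rewrite lerXn2r ?nnegrE ?(ltW e0) // distrC; exact: sub0.
move=> x xz xx; have Hl := Hlow x xx; rewrite cE //.
case: Hw => _ _ /(_ x t1 st1) Hw _ _.
suff : k%:R * c / Num.sqrt (t1 - s) ^+ n <= (r ^+ n)^-1 / 4.
  by clear -Hw Hl; lra.
(* As [t1 >= 3 t0 / 4] and [s < t0 / 4], the elapsed time [t1 - s] exceeds [t0 / 4]. *)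
have Hq : Num.sqrt t0 / 2 <= Num.sqrt (t1 - s).
  rewrite -[leLHS]gtr0_norm ?divr_gt0 // -sqrtr_sqr ler_wsqrtr //.
  by rewrite expr_div_n sqr_sqrtr ?(ltW t00) //; clear -st t1a t00; lra.
apply: (@le_trans _ _ (N%:R * c / (Num.sqrt t0 / 2) ^+ n)).
  apply: ler_pM.
  - by rewrite mulr_ge0 // ltW.
  - by rewrite invr_ge0 exprn_ge0 // sqrtr_ge0.
  - by apply: ler_wpM2r; [exact: ltW|rewrite ler_nat ltnW].
  - rewrite lef_pV2 ?posrE ?exprn_gt0 ?divr_gt0 ?sqrtr_gt0 ?subr_gt0 //.
    by rewrite lerXn2r ?nnegrE ?sqrtr_ge0 // divr_ge0 // sqrtr_ge0.
have lam0 : 0 < lam by exact: lt_le_trans lam4.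
apply: (@le_trans _ _ ((lam / Num.sqrt t0) ^+ n / 4)).
  rewrite !expr_div_n invf_div ler_pdivlMr // mulrAC.
  rewrite mulrA ler_pM2r ?invr_gt0 ?exprn_gt0 //.
  by apply: le_trans lamn; rewrite le_eqVlt; apply/orP; left; apply/eqP; ring.
apply: ler_wpM2r => //; rewrite -exprVn lerXn2r ?nnegrE ?invr_ge0 ?(ltW r0) //.
  by rewrite divr_ge0 ?sqrtr_ge0 // ltW.
by rewrite -invf_div lef_pV2 ?posrE // divr_gt0.
Qed.

(** * From local bounds to the maximum over [K] *)

Lemma powR_half_natE {R : realType} (n : nat) (t : R) : 0 <= t ->
  t `^ (- (n%:R / 2)) = (Num.sqrt t ^+ n)^-1.
Proof.
move=> t0; by rewrite powRN mulrC powRrM powR12_sqrt // powR_mulrn // sqrtr_ge0.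
Qed.

(** Compactness is used in its near-covering form, for the filter of pairs [(D, t)] with [D] tending
    to infinity and [t] to [0^'+]: each local bound survives enlarging [D] and shrinking [t], so one
    choice serves all of [K]. *)
Lemma compact_uniform_bound {R : realType} {n : nat} (K : set 'rV[R]_n)
    (u : 'rV[R]_n -> R -> R) :
  compact K ->
  (forall z, K z -> exists C eta : R, 0 < eta /\ forall x t, cube z eta x ->
    0 < t -> t < eta -> u x t <= C / Num.sqrt t ^+ n) ->
  exists C eta : R, [/\ 0 < C, 0 < eta & forall x t, K x -> 0 < t -> t < eta ->
    u x t <= C / Num.sqrt t ^+ n].
Proof.
move=> /compact_near_coveringP cK Hloc.
have := cK _ (filter_prod (+oo : set_system R) (0^'+ : set_system R))
  (fun (p : R * R) x => u x p.2 <= p.1 / Num.sqrt p.2 ^+ n) _.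
case.
  move=> z /Hloc[C [eta [eta0 H]]].
  exists (cube z eta, [set p : R * R | C <= p.1 /\ 0 < p.2 < eta]); last first.
    move=> [x [D t]] [/= xz [CD /andP[t0 te]]].
    apply: le_trans (H x t xz t0 te) _.
    by apply: ler_wpM2r; rewrite ?invr_ge0 ?exprn_ge0 ?sqrtr_ge0.
  split => /=.
    apply/nbhs_ballP; exists eta => //= x; rewrite -ball_normE /= => xz.
    by apply/cube_normE; [exact: ltW|rewrite distrC; exact: ltW].
  exists ([set D | C <= D], [set t | 0 < t < eta]); last by move=> [D t] [].
  split => /=; first by apply: nbhs_pinfty_ge; exact: num_real.
  near=> t; apply/andP; split; near: t; first exact: nbhs_right_gt.
  exact: nbhs_right_lt.
move=> [A B] [/= Ainf B0] HAB.
have [C [AC C1]] : exists C, A C /\ 0 < C.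
  have H : \forall C \near +oo, A C /\ 0 < C.
    by near=> C; split; near: C => //; apply: nbhs_pinfty_gt; exact: num_real.
  by have [C HC] := filter_ex H; exists C.
move: B0 => /nbhs_ballP[eta /= eta0 HB].
exists C, eta; split => // x t Kx t0 te.
apply: (HAB (C, t) _ x Kx); split => //=; apply: HB => //=.
by rewrite /ball /= sub0r normrN gtr0_norm.
Unshelve. all: by end_near. Qed.

Theorem theorem3p1 (R : realType) (n : nat) (T b : R) (Omega : set 'rV[R]_n)
    (u : 'rV[R]_n -> R -> R)
    (n_ge1 : (1 <= n)%N) (T_gt0 : 0 < T) (b_gt0 : 0 < b)
    (Omega_open : open Omega)
    (u_C21 : C21_on Omega `]0, T[ u)
    (u_ge0 : forall (x : 'rV[R]_n) (t : R), Omega x -> 0 < t < T -> 0 <= u x t)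
    (u_ineq : forall (x : 'rV[R]_n) (t : R), Omega x -> 0 < t < T ->
       0 <= derive1 (u x) t - laplacian (u^~ t) x
         <= b * (u x t + 1 / Num.sqrt t ^+ n) `^ (1 + 2 / n%:R)) :
  forall K : set 'rV[R]_n, compact K -> K `<=` Omega -> K !=set0 ->
    exists M : R -> R,
      (forall t : R, 0 < t < T -> is_max [set u x t | x in K] (M t)) /\
      M =O_ (0^'+) (fun t : R => t `^ (- (n%:R / 2))).
Proof.
move=> K cK KO K0.
have cu x t : Omega x -> 0 < t < T ->
    {for (x, t), continuous (fun p : 'rV[R]_n * R => u p.1 p.2)}.
  move=> Ox tT; case: u_C21 => + _ _ _; rewrite /cont_on continuous_open_subspace.
    by apply; rewrite inE; split => //=; rewrite in_itv.
  rewrite openE => -[y s] [/= Oy sT].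
  exists (Omega, `]0, T[%classic) => //.
  by split; apply: open_nbhs_nbhs; split => //; exact: itv_open.
have maxE t : 0 < t < T -> exists m, is_max [set u x t | x in K] m.
  move=> tT; have [|x /set_mem Kx Hx] := @compact_EVT_max _ _ (u^~ t) K K0 cK.
    apply: continuous_in_subspaceT => x /set_mem /KO Ox.
    apply: (@continuous_comp _ _ _ (fun x => (x, t))
      (fun p : 'rV[R]_n * R => u p.1 p.2)); last exact: cu.
    exact: (cvg_pair (@cvg_id _ (nbhs x))
      (@cvg_cst _ t _ (nbhs x) (nbhs_filter x))).
  exists (u x t); split; first by exists x.
  by move=> _ [y Ky <-]; apply: Hx; exact: mem_set.
(* [get] picks the maximum for [0 < t < T] and an arbitrary default elsewhere, which the behaviour
   at [0^'+] does not see. *)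
exists (fun t => get (is_max [set u x t | x in K])).
have HM t : 0 < t < T -> is_max [set u x t | x in K]
    (get (is_max [set u x t | x in K])).
  by move=> /maxE; exact: getPex.
split => //; apply/eqO_exP.
have [|C [eta [C0 eta0 Hb]]] := compact_uniform_bound K u cK.
  move=> z /KO Oz.
  have /nbhs_ballP[eps /= eps0 Heps] : nbhs z Omega.
    exact: open_nbhs_nbhs.
  have cO x : cube z (eps / 2) x -> Omega x.
    move=> /cube_normE; rewrite divr_ge0 ?(ltW eps0) // => /(_ isT) xz.
    apply: Heps; rewrite -ball_normE /= distrC; lra.
  apply: (local_bound b T (eps / 2)) => //; first by rewrite divr_gt0.
  move=> x t /cO Ox t0 tT; have tT' : 0 < t < T by rewrite t0.
  split; [exact: u_ge0|exact: cu|].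
  exists (derive1 (u x) t - laplacian (u^~ t) x); last exact: u_ineq.
  by apply: heat_at_C21 u_C21 _ _ => //=; rewrite in_itv.
exists C => //; near=> t.
have t0 : 0 < t by near: t; exact: nbhs_right_gt.
have tT : t < T by near: t; exact: nbhs_right_lt.
have te : t < eta by near: t; exact: nbhs_right_lt.
have [|[x Kx <-] _] := HM t; first by rewrite t0.
rewrite powR_half_natE ?(ltW t0) // !ger0_norm.
- exact: Hb.
- by rewrite invr_ge0 exprn_ge0 // sqrtr_ge0.
- by apply: u_ge0; [exact: KO|rewrite t0].
Unshelve. all: by end_near. Qed.
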